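(* Let $(X,\mathscr A,\mu)$ be a $\sigma$-finite measure space, let $\phi\colon X\to X$ and $w\colon X\to\mathbb C$ be $\mathscr A$-measurable, and assume that the weighted composition operator $C_{\phi,w}$ is (well defined and) a bounded operator on the whole of $L^2(\mu)$. Then the following conditions are equivalent: (A) $C_{\phi,w}$ is centered; (B) for every $n\in\mathbb N$, $C_{\phi^n,w_{n,\phi}}=C_{\phi^n,w_{\phi,n}}$; (C) for every $n\in\mathbb N$, $\mathsf h_{\phi,w}\circ\phi\cdot \mathsf h_{\phi,w}\circ\phi^2\cdots \mathsf h_{\phi,w}\circ\phi^n=\mathsf h_{\phi^n,w_n}\circ\phi^n$ a.e. $[\mu_{w_n}]$; (D) for every $n\in\mathbb N$, $\mathsf h_{\phi^n,w_n}=\mathsf E_{\phi,w}(\mathsf h_{\phi^n,w_n})$ a.e. $[\mu_w]$; (E) for every $n\in\mathbb N$, $\mathsf h_{\phi^{n+1},w_{n+1}}\circ\phi=\mathsf h_{\phi^n,w_n}\cdot \mathsf h_{\phi,w}\circ\phi$ a.e. $[\mu_w]$; (F) for every $n\in\mathbb N$, $\mathsf h_{\phi,w}=\mathsf E_{\phi^n,w_n}(\mathsf h_{\phi,w})$ a.e. $[\mu_{w_n}]$; (G) for every $n\in\mathbb N$, $\mathsf E_{\phi^n,w_n}(\mathsf h_{\phi,w})\circ\phi=\mathsf E_{\phi^{n+1},w_{n+1}}(\mathsf h_{\phi,w}\circ\phi)$ a.e. $[\mu_{w_{n+1}}]$; (H) for every $n,k\in\mathbb N$, $\mathsf h_{\phi^n,w_n}=\mathsf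 E_{\phi^k,w_k}(\mathsf h_{\phi^n,w_n})$ a.e. $[\mu_{w_k}]$.
   Context: $\mathbb N=\{1,2,\dots\}$. A bounded operator $T$ on a complex Hilbert space is centered if all the operators $T^{n}T^{*n}$, $T^{*n}T^{n}$, $n\in\mathbb N$, commute with each other. For a measurable $\psi\colon X\to X$ and a measurable $u\colon X\to\mathbb C$, put $\mu_u(\sigma)=\int_\sigma|u|^2\,d\mu$ and $\mu_u\circ\psi^{-1}(\sigma)=\mu_u(\psi^{-1}(\sigma))$ for $\sigma\in\mathscr A$. If $\mu_u\circ\psi^{-1}\ll\mu$, then the weighted composition operator $C_{\psi,u}$ is well defined by $\mathcal D(C_{\psi,u})=\{f\in L^2(\mu): u\cdot(f\circ\psi)\in L^2(\mu)\}$, $C_{\psi,u}f=u\cdot(f\circ\psi)$, and $\mathsf h_{\psi,u}\colon X\to[0,\infty]$ denotes the Radon–Nikodym derivative $d(\mu_u\circ\psi^{-1})/d\mu$. If $C_{\psi,u}$ is densely defined (equivalently $\mathsf h_{\psi,u}<\infty$ a.e. $[\mu]$), then $\mathsf E_{\psi,u}(f)$ denotes the conditional expectation of $f$ (for $f$ measurable with values in $[0,\infty]$, or complex $f\in L^p(\mu_u)$, $1\le p\le\infty$) with respect to the $\sigma$-algebra $\psi^{-1}(\mathscr A)$ and the measure $\mu_u$. $\phi^n$ is the $n$-fold composition of $\phi$ with itself ($\phi^0=\mathrm{id}$); $w_0=\chi_X$ and $w_{n}=\prod_{j=0}^{n-1}w\circ\phi^j$ for $n\in\mathbb N$. When $C_{\phi,w}$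 is well defined, so is $C_{\phi^n,w_n}$ for every $n\in\mathbb N$. For $n\in\mathbb N$, $$w_{\phi,n}=\frac{w}{\sqrt{\mathsf h_{\phi,w}\circ\phi}}\cdot\frac{w\circ\phi}{\sqrt{\mathsf h_{\phi,w}\circ\phi^2}}\cdots\frac{w\circ\phi^{n-1}}{\sqrt{\mathsf h_{\phi,w}\circ\phi^n}},\qquad w_{n,\phi}=\frac{w_n}{\sqrt{\mathsf h_{\phi^n,w_n}\circ\phi^n}},$$ where both functions are understood to be $0$ on $\{w_n=0\}$ (the denominators are nonzero $\mu$-a.e. on $\{w_n\ne0\}$). *)

(* Defs.v *)
From HB Require Import structures.
From mathcomp Require Import all_boot all_order all_algebra.
From mathcomp Require Import complex.
From mathcomp Require Import all_classical all_reals all_analysis.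
From mathcomp Require Import measurable_realfun.

Set Implicit Arguments.
Unset Strict Implicit.
Unset Printing Implicit Defensive.

Import Order.TTheory GRing.Theory Num.Theory.
Import numFieldNormedType.Exports.
Import Normc.

Local Open Scope classical_set_scope.
Local Open Scope ring_scope.

(* The Borel sigma-algebra of R[i], transported from R * R. *)
Section complex_measurable.
Context {R : realType}.

Definition complex_pair (z : R[i]) : R * R :=
  (complex.Re z, complex.Im z).

Definition complex_measurable : set (set R[i]) :=
  preimage_set_system setT complex_pair measurable.

Let sigma_algebra_complex : sigma_algebra setT complex_measurable.
Proof. exact/sigma_algebra_preimage/sigma_algebra_measurable. Qed.

Let complex_measurable0 : complex_measurable set0.
Proof. by case: sigma_algebra_complex. Qed.

Let complex_measurableC A : complex_measurable A -> complex_measurable (~` A).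
Proof. by case: sigma_algebra_complex => _ + _ => /[apply]; rewrite setTD. Qed.

Let complex_measurable_bigcup (F : (set R[i])^nat) :
  (forall i, complex_measurable (F i)) -> complex_measurable (\bigcup_i F i).
Proof. by case: sigma_algebra_complex => _ _; exact. Qed.

HB.instance Definition _ := isPointed.Build R[i] 0.
HB.instance Definition _ := @isMeasurable.Build default_measure_display R[i]
  complex_measurable complex_measurable0 complex_measurableC
  complex_measurable_bigcup.

Lemma measurable_fun_complexP d (X : measurableType d) (f : X -> R[i]) :
  measurable_fun setT f <->
  measurable_fun setT (fun x => complex.Re (f x)) /\
  measurable_fun setT (fun x => complex.Im (f x)).
Proof.
have -> : measurable_fun setT f <-> measurable_fun setT (complex_pair \o f).
  split=> mf _ A mA.
    by have := mf measurableT (complex_pair @^-1` A); apply; exists A; rewrite ?setTI.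
  by case: mA => B mB <-; rewrite setTI; exact: mf.
exact: measurable_fun_pairP.
Qed.

Lemma measurable_mulC d (X : measurableType d) (f g : X -> R[i]) :
  measurable_fun setT f -> measurable_fun setT g ->
  measurable_fun setT (fun x => f x * g x).
Proof.
move=> /measurable_fun_complexP[rf imf] /measurable_fun_complexP[rg img].
apply/measurable_fun_complexP; split.
  rewrite (_ : (fun x => _) = (fun x => complex.Re (f x) * complex.Re (g x) -
      complex.Im (f x) * complex.Im (g x))); last first.
    by apply/funext => x; case: (f x) (g x) => [a b] [c e].
  by apply: measurable_funB; exact: measurable_funM.
rewrite (_ : (fun x => _) = (fun x => complex.Re (f x) * complex.Im (g x) +
    complex.Im (f x) * complex.Re (g x))); last first.
  by apply/funext => x; case: (f x) (g x) => [a b] [c e].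
by apply: measurable_funD; exact: measurable_funM.
Qed.

Lemma measurable_sqr_normc d (X : measurableType d) (f : X -> R[i]) :
  measurable_fun setT f -> measurable_fun setT (fun x => normc (f x) ^+ 2).
Proof.
move=> /measurable_fun_complexP[rf imf].
rewrite (_ : (fun x => _) =
    (fun x => complex.Re (f x) ^+ 2 + complex.Im (f x) ^+ 2)).
  by apply: measurable_funD; exact: measurable_funX.
apply/funext => x; case: (f x) => a b /=.
by rewrite sqr_sqrtr// addr_ge0// sqr_ge0.
Qed.

End complex_measurable.

Section L2.
Context d (X : measurableType d) (R : realType).
Variable mu : {measure set X -> \bar R}.

(* The elements are classes of measurable functions modulo mu-a.e. equality;
   they coerce to functions through a chosen representative. *)
Definition L2 : Type := {F : {mfun_ mu, X >-> R[i]} |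
  `[< (\int[mu]_x ((normc (F x) ^+ 2)%:E) < +oo)%E >]}.

Definition L2_fun (F : L2) : X -> R[i] := val F.
Coercion L2_fun : L2 >-> Funclass.

Definition L2dot (F G : L2) : R[i] :=
  Complex (\int[mu]_x complex.Re (F x * conjc (G x)))
          (\int[mu]_x complex.Im (F x * conjc (G x))).

Definition L2norm (F : L2) : R := Num.sqrt (\int[mu]_x (normc (F x) ^+ 2)).

Definition bounded_op (T : L2 -> L2) : Prop :=
  exists M : R, forall F, L2norm (T F) <= M * L2norm F.

End L2.
Arguments L2dot {d X R} mu F G.

Definition is_adjoint (H C : Type) (dot : H -> H -> C) (T S : H -> H) : Prop :=
  forall f g, dot (T f) g = dot f (S g).

(* The adjoint of a bounded operator exists and is unique; [iter n S] is then
   the [n]th power of the adjoint. *)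
Definition centered (H C : Type) (dot : H -> H -> C) (T : H -> H) : Prop :=
  exists2 S, is_adjoint dot T S &
    let family := [set A | exists2 n, (0 < n)%N &
      A = iter n T \o iter n S \/ A = iter n S \o iter n T] in
    forall A B, family A -> family B -> A \o B = B \o A.

Section weighted_composition.
Context d (X : measurableType d) (R : realType).
Variable mu : {measure set X -> \bar R}.
Implicit Types (psi : X -> X) (u : X -> R[i]) (A B : set X).

Definition wmeas u A : \bar R := (\int[mu]_(x in A) (normc (u x) ^+ 2)%:E)%E.

Section wmeas_measure.
Variable u : {mfun X >-> R[i]}.

Let wmeas0 : wmeas u set0 = 0%E.
Proof. by rewrite /wmeas integral_set0. Qed.

Let wmeas_ge0 A : (0 <= wmeas u A)%E.
Proof. by apply: integral_ge0 => x _; rewrite lee_fin sqr_ge0. Qed.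

Let wmeas_sigma_additive : semi_sigma_additive (wmeas u).
Proof.
move=> /= F mF tF mUF; rewrite /wmeas ge0_integral_bigcup//=.
- apply: is_cvg_ereal_nneg_natsum_cond => n _ _.
  by apply: integral_ge0 => x _; rewrite lee_fin sqr_ge0.
- apply: measurable_funTS; apply/measurable_EFinP.
  exact: measurable_sqr_normc.
- by move=> x _; rewrite lee_fin sqr_ge0.
Qed.

HB.instance Definition _ := isMeasure.Build _ _ _ (wmeas u)
  wmeas0 wmeas_ge0 wmeas_sigma_additive.
End wmeas_measure.

Definition wc_well_defined psi u : Prop :=
  pushforward (wmeas u) psi `<< mu.

(* Operators in L^2 that need not be everywhere defined are identified with
   their graphs: [(F, G)] is in [wcomp psi u] iff [u * (F \o psi)] is a
   representative of [G]. When [wc_well_defined psi u] holds this does not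
   depend on the representative of [F]. *)
Definition wcomp psi u : set (L2 mu * L2 mu) :=
  [set FG : L2 mu * L2 mu | (fun x => u x * FG.1 (psi x)) = FG.2 %[ae mu]].

Definition is_wderiv psi u (h : X -> \bar R) : Prop :=
  [/\ forall x, (0 <= h x)%E, measurable_fun setT h &
      forall A, measurable A ->
        pushforward (wmeas u) psi A = (\int[mu]_(x in A) h x)%E].

(* A chosen version of the Radon-Nikodym derivative, with values in [0, +oo]. *)
Definition wderiv psi u : X -> \bar R := xget (cst 0%E) (is_wderiv psi u).

(* [g] is a conditional expectation of [f >= 0] with respect to the
   sigma-algebra [psi^-1(measurable)] and the measure [wmeas u]. *)
Definition is_wcondexp psi u (f g : X -> \bar R) : Prop :=
  let G := preimage_set_system setT psi measurable in
  [/\ forall x, (0 <= g x)%E,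
      forall B : set (\bar R), measurable B -> G (g @^-1` B) &
      forall A, G A ->
        (\int[wmeas u]_(x in A) g x = \int[wmeas u]_(x in A) f x)%E].

Definition wcondexp psi u (f : X -> \bar R) : X -> \bar R :=
  xget (cst 0%E) (is_wcondexp psi u f).

Section iterates.
Variables (phi : X -> X) (w : X -> R[i]).

Definition wprod n : X -> R[i] := fun x => \prod_(j < n) w (iter j phi x).

(* The weights w_{phi,n} ([wprod_normal]) and w_{n,phi} ([wprod_polar]), both
   set to 0 where w_n vanishes. [fine] sends the value +oo to 0, whose inverse
   is 0, in accordance with 1 / +oo = 0. *)
Definition wprod_normal n : X -> R[i] := fun x =>
  if wprod n x == 0 then 0 else
  \prod_(j < n) (w (iter j phi x) /
    (Num.sqrt (fine (wderiv phi w (iter j.+1 phi x))))%:C%C).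

Definition wprod_polar n : X -> R[i] := fun x =>
  if wprod n x == 0 then 0 else
  wprod n x /
    (Num.sqrt (fine (wderiv (iter n phi) (wprod n) (iter n phi x))))%:C%C.

End iterates.

Section wprod_measurable.
Variables (phi : {mfun X >-> X}) (w : {mfun X >-> R[i]}).

Lemma measurable_iter n : measurable_fun setT (iter n phi).
Proof.
by elim: n => [|n ih]; [exact: measurable_id|exact: measurableT_comp].
Qed.

Lemma measurable_wprod n : measurable_fun setT (wprod phi w n).
Proof.
elim: n => [|n ih].
  rewrite (_ : wprod _ _ _ = cst 1); first exact: measurable_cst.
  by apply/funext => x; rewrite /wprod big_ord0.
rewrite (_ : wprod _ _ _ = fun x => wprod phi w n x * w (iter n phi x)).
  by apply: measurable_mulC => //; apply: measurableT_comp => //; exact: measurable_iter.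
by apply/funext => x; rewrite /wprod big_ord_recr.
Qed.

HB.instance Definition _ n :=
  isMeasurableFun.Build _ _ _ _ (wprod phi w n) (measurable_wprod n).
End wprod_measurable.

End weighted_composition.

Arguments wcomp {d X R} mu psi u.

(* Main.v *)
Require Import Defs.
From HB Require Import structures.
From mathcomp Require Import all_boot all_order all_algebra.
From mathcomp Require Import complex.
From mathcomp Require Import all_classical all_reals all_analysis.
From mathcomp Require Import measurable_realfun.
From mathcomp Require Import ring lra.

(** Write T for the operator, S for its adjoint, nu_n for the measure |w_n|^2 mu
    and h_n for the derivative of the image of nu_n under phi^n with respect to
    mu. Then T^n f = w_n . (f o phi^n), and S^n T^n is the multiplication by
    h_n. The relation w_(n+k) = w_n . (w_k o phi^n) becomes a change of variables
    ([nu_iter_transfer]): the integral of f o phi^n over phi^-n B for nu_(n+k) is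
    the integral of f h_n over B for nu_k. It shows that E_k(h_n) is
    (h_(n+k) / h_k) o phi^k, so that h_n = E_k(h_n) amounts to the relation
      h_(n+k) o phi^k = h_n . (h_k o phi^k)   a.e. for nu_k,
    called [factorises n k] below ([condexp_h_iter_fixP]). Conditions (D) and (E)
    are the relations (n, 1), condition (F) the relations (1, n), and (H) all of
    them.

    The relations (n, 1) compose to all relations ([factorises_all]), and the
    relations (1, n) telescope to the product formula (C)
    ([factorises_product]). Going back from (C) to (n, 1) is the delicate step
    ([product_factorises]). Composing with phi^n loses the set where h_n
    vanishes, so (C) gives the relation (n, 1) only where h_n > 0. This still
    yields h_n . (h_1 o phi) <= h_(n+1) o phi, and over phi^-1 A both sides have
    the same integral, that of h_1 h_(n+1) over A, so they are equal.

    Condition (G) says that the conditional variance of h_1 given phi^n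
    vanishes, which is (F) ([condexp_shift_factorises]). Condition (B) compares
    two weights whose moduli are |w_n| divided by the square roots of the two
    sides of (C) ([weights_eq_product]).

    If T is centered, applying both products of T S and S^n T^n to T 1_A gives
    w . (h_(n+1) 1_A) o phi = h_n w . (h_1 1_A) o phi, which is the relation
    (n, 1) ([commute_factorises]). Conversely, the relation (k, n) makes h_k
    equal to some g o phi^n for nu_n, hence h_k . T^n f = T^n (g f). Taking
    adjoints, the multiplication by h_k commutes with T^n S^n
    ([factorises_commute]), and the other commutations follow by algebra
    ([factorises_centered]). The adjoint itself is built from Radon-Nikodym
    densities of images of the measures (w . conj g) mu ([adjoint_exists]).

    Boundedness of T enters through a single inequality, nu_1 (phi^-1 A) <= K mu A
    ([wmeas_bound]): it gives h_n <= K^n, and with it every integrability that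
    is needed. *)

Set Implicit Arguments.
Unset Strict Implicit.
Unset Printing Implicit Defensive.

Import Order.TTheory GRing.Theory Num.Theory.
Import numFieldNormedType.Exports.
Import Normc.

Local Open Scope classical_set_scope.
Local Open Scope ring_scope.

(** * Integration against a density *)

Section measure_lemmas.
Context d (X : measurableType d) (R : realType).
Local Open Scope ereal_scope.
Import HBNNSimple.

(** The hypothesis is the case of indicators; simple functions follow by
    linearity and all functions by monotone convergence. The density is real
    valued so that multiplying by it is continuous on the extended reals. *)
Lemma ge0_integral_density (mu nu : {measure set X -> \bar R}) (q : X -> R) :
  measurable_fun setT q -> (forall x, (0 <= q x)%R) ->
  (forall A, measurable A -> nu A = \int[mu]_(x in A) (q x)%:E) ->
  forall (f : X -> \bar R) (A : set X), measurable_fun setT f -> (forall x, 0 <= f x) ->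
  measurable A ->
  \int[nu]_(x in A) f x = \int[mu]_(x in A) (f x * (q x)%:E).
Proof.
move=> mq q0 nuE f A mf f0 mA.
have mEq : measurable_fun A (EFin \o q).
  by apply/measurable_EFinP; exact: measurable_funTS.
have mfA : measurable_fun A f by exact: measurable_funTS.
pose g := nnsfun_approx mA mfA.
have cvg_g x : A x -> (g n x)%:E @[n --> \oo] --> f x.
  by move=> Ax; apply: cvg_nnsfun_approx.
have mg n : measurable_fun A (EFin \o g n).
  by apply/measurable_EFinP; exact: measurable_funTS.
have gnd x : {homo (fun n => (g n x)%:E) : m n / (m <= n)%N >-> m <= n}.
  by move=> m n mn; rewrite lee_fin; exact/lefP/nd_nnsfun_approx.
transitivity (limn (fun n => \int[nu]_(x in A) (g n x)%:E)).
  rewrite -monotone_convergence//.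
  - by apply: eq_integral => x /[!inE] Ax; apply/esym/cvg_lim => //; exact: cvg_g.
  - by move=> n x _; rewrite lee_fin.
transitivity (limn (fun n => \int[mu]_(x in A) ((g n x)%:E * (q x)%:E))); last first.
  rewrite -monotone_convergence//.
  - apply: eq_integral => x /[!inE] Ax; apply/cvg_lim => //.
    by apply: cvgeZr => //; exact: cvg_g.
  - by move=> n; exact: (emeasurable_funM (mg n) mEq).
  - by move=> n x _; rewrite mule_ge0// lee_fin.
  - by move=> x _ m n mn; apply: lee_wpmul2r; rewrite ?lee_fin//; exact/lefP/nd_nnsfun_approx.
congr (limn _); apply/funext => n.
have mgr r : measurable (g n @^-1` [set r]) by [].
transitivity (\sum_(r \in range (g n)) \int[nu]_(x in A) (r * \1_(g n @^-1` [set r]) x)%:E).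
  under eq_integral do rewrite fimfunE -fsumEFin//.
  rewrite ge0_integral_fsum//.
  - by move=> r; apply/measurable_EFinP; apply: measurable_funM.
  - by move=> r x _; rewrite nnfun_muleindic_ge0.
transitivity (\sum_(r \in range (g n))
    \int[mu]_(x in A) ((r * \1_(g n @^-1` [set r]) x)%:E * (q x)%:E)); last first.
  rewrite -ge0_integral_fsum//.
  - apply: eq_integral => x _; rewrite -ge0_mule_fsuml; last first.
      by move=> r; rewrite nnfun_muleindic_ge0.
    by rewrite fsumEFin// -fimfunE.
  - move=> r; apply: emeasurable_funM => //.
    by apply/measurable_EFinP; exact: measurable_funM.
  - by move=> r x _; rewrite mule_ge0 ?lee_fin// -lee_fin EFinM nnfun_muleindic_ge0.
apply: eq_fsbigr => r /[!inE] -[x _ rE].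
have r0 : (0 <= r)%R by rewrite -rE.
rewrite integralZl_indic_nnsfun// integral_indic// nuE; last exact: measurableI.
under [RHS]eq_integral do rewrite EFinM -muleA.
rewrite ge0_integralZl//; last 2 first.
- apply: emeasurable_funM => //.
  by apply/measurable_EFinP; apply: measurable_indic.
- by move=> y _; rewrite mule_ge0 ?lee_fin.
congr (_ * _); rewrite setIC integral_mkcondr.
by apply: eq_integral => y _; rewrite epatch_indic muleC.
Qed.

End measure_lemmas.

(** * Comparing functions through their integrals *)

Section comparison.
Context d (X : measurableType d) (R : realType).
Local Open Scope ereal_scope.

Lemma sigma_finite_trivIset (mu : {sigma_finite_measure set X -> \bar R}) :
  exists F : (set X)^nat, [/\ forall i, measurable (F i),
    trivIset setT F, \bigcup_i F i = setT & forall i, mu (F i) < +oo].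
Proof.
have [F TF /all_and2[mF Foo]] := sigma_finiteT mu.
have mE k : measurable (seqDU F k).
  by apply: measurableD => //; exact: bigsetU_measurable.
exists (seqDU F); split => //.
- by rewrite -seqDU_bigcup_eq TF.
- move=> k; rewrite (le_lt_trans _ (Foo k))// le_measure ?inE//.
  exact: subDsetl.
Qed.

(** Covers the set where one function is smaller than another by level sets
    indexed by natural numbers, in place of pairs of rational numbers. *)
Lemma grid_between (x y : \bar R) : 0 <= x -> x < y -> exists n m : nat,
  x <= ((m%:R / n.+1%:R)%:E) /\ ((m.+1%:R / n.+1%:R)%:E) <= y.
Proof.
move=> x0 xy.
have xfin : x \is a fin_num by rewrite ge0_fin_numE// (lt_le_trans xy)// leey.
have [z [zfin xz zy]] : exists z : R, [/\ (0 <= z)%R, (fine x < z)%R & z%:E <= y].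
  case: y xy => [y xy|xy|]; last by rewrite ltNge leNye.
    exists y; split => //; last by rewrite -lte_fin fineK.
    by rewrite -lee_fin (le_trans x0)// ltW.
  exists (fine x + 1)%R; split; rewrite ?leey// ?ltrDl//.
  by rewrite addr_ge0// fine_ge0.
set e := (z - fine x)%R.
have e0 : (0 < e)%R by rewrite subr_gt0.
(* a step 1/n.+1 below half the gap, so that two consecutive multiples fit in it *)
pose n := Num.truncn (2 / e)%R.
have n0 : (0 < n.+1%:R :> R)%R by rewrite ltr0n.
have ne : (2 / n.+1%:R < e)%R.
  by rewrite ltr_pdivrMr// mulrC -ltr_pdivrMr//; exact: truncnS_gt.
pose m := (Num.truncn (fine x * n.+1%:R)%R).+1.
exists n, m; split.
  rewrite -(fineK xfin) lee_fin ler_pdivlMr//; apply/ltW; exact: truncnS_gt.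
apply: le_trans zy; rewrite lee_fin ler_pdivrMr//.
have : (m%:R <= fine x * n.+1%:R + 1 :> R)%R.
  by rewrite /m -natr1 lerD2r truncn_le// mulr_ge0// fine_ge0.
move=> mx; rewrite -natr1; apply: (le_trans (lerD mx (lexx _))).
rewrite -addrA -lerBrDl -mulrBl -/e.
by move: ne; rewrite ltr_pdivrMr// => /ltW.
Qed.

(** On a set of finite measure where f <= p < q <= g, the inequality between the
    integrals reads q nu(B) <= p nu(B), so the set is null; countably many of
    these sets cover the points where f < g. Testing level sets only is what
    makes the criterion usable when the integrals of f and g are compared on a
    sub-sigma-algebra for which both are measurable. *)
Lemma ae_le_of_integral (nu : {measure set X -> \bar R}) (f g : X -> \bar R)
    (F : (set X)^nat) :
  measurable_fun setT f -> measurable_fun setT g ->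
  (forall x, 0 <= f x) -> (forall x, 0 <= g x) ->
  (forall i, measurable (F i)) -> \bigcup_i F i = setT ->
  (forall i, nu (F i) < +oo) ->
  (forall i (p q : R), (0 <= p < q)%R ->
    forall B, B = F i `&`
      (f @^-1` [set y | y <= p%:E] `&` g @^-1` [set y | q%:E <= y]) ->
    \int[nu]_(x in B) g x <= \int[nu]_(x in B) f x) ->
  \forall x \ae nu, g x <= f x.
Proof.
move=> mf mg f0 g0 mF UF Foo H.
pose B n m i := F i `&` (f @^-1` [set y | y <= (m%:R / n.+1%:R)%:E] `&`
                  g @^-1` [set y | (m.+1%:R / n.+1%:R)%:E <= y]).
apply: (@negligibleS _ _ _ _ (\bigcup_n \bigcup_m \bigcup_i B n m i)).
  move=> x /= /negP; rewrite -ltNge => /(grid_between (f0 x)) [n [m [fm mgx]]].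
  have : (\bigcup_i F i) x by rewrite UF.
  by move=> [i _ Fx]; exists n => //; exists m => //; exists i.
apply: negligible_bigcup => n; apply: negligible_bigcup => m.
apply: negligible_bigcup => i.
set p := (m%:R / n.+1%:R : R)%R; set q := (m.+1%:R / n.+1%:R : R)%R.
have p0 : (0 <= p)%R by rewrite divr_ge0.
have pq : (p < q)%R by rewrite ltr_pM2r ?invr_gt0 ?ltr0n// ltr_nat.
have mB : measurable (B n m i).
  apply: measurableI => //; apply: measurableI.
    by have := emeasurable_fun_infty_c measurableT mf p%:E; rewrite setTI.
  by have := emeasurable_fun_c_infty measurableT mg q%:E; rewrite setTI.
apply/negligibleP => //.
have Boo : nu (B n m i) < +oo.
  by apply: le_lt_trans (Foo i); apply: le_measure; rewrite ?inE//; exact: subIsetl.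
have H1 : \int[nu]_(x in B n m i) g x <= \int[nu]_(x in B n m i) f x.
  by apply: (H i p q); rewrite ?p0 ?pq.
have : q%:E * nu (B n m i) <= p%:E * nu (B n m i).
  rewrite -!integral_cst//.
  apply: (@le_trans _ _ (\int[nu]_(x in B n m i) g x)).
    apply: ge0_le_integral => //.
    - by move=> x _; rewrite lee_fin (le_trans p0)// ltW.
    - exact: measurable_funTS.
    - by move=> x [_ []].
  apply: (le_trans H1); apply: ge0_le_integral => //.
  - exact: measurable_funTS.
  - by move=> x [_ []].
have Bfin : nu (B n m i) \is a fin_num by rewrite ge0_fin_numE.
rewrite -(fineK Bfin) -!EFinM lee_fin => le.
suff fB0 : fine (nu (B n m i)) = 0%R.
  exact: (etrans (esym (fineK Bfin)) (congr1 EFin fB0)).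
apply/eqP.
rewrite eq_le fine_ge0// andbT leNgt; apply/negP => gt0.
by move: le; rewrite ler_pM2r// leNgt pq.
Qed.

(** Since f <= g off any level set, a total integral of g not above that of f
    leaves no room for g to exceed f on the level set. *)
Lemma ae_ge_of_integral (nu : {measure set X -> \bar R}) (f g : X -> \bar R)
    (F : (set X)^nat) :
  measurable_fun setT f -> measurable_fun setT g ->
  (forall x, 0 <= f x) -> (forall x, 0 <= g x) ->
  (forall i, measurable (F i)) -> \bigcup_i F i = setT ->
  (forall i, nu (F i) < +oo) -> (forall i, \int[nu]_(x in F i) f x < +oo) ->
  (\forall x \ae nu, f x <= g x) ->
  (forall i, \int[nu]_(x in F i) g x <= \int[nu]_(x in F i) f x) ->
  \forall x \ae nu, g x <= f x.
Proof.
move=> mf mg f0 g0 mF UF Foo foo fg gf.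
apply: (ae_le_of_integral mf mg f0 g0 mF UF Foo) => i p q _ B BE.
have mB : measurable B.
  rewrite BE; apply: measurableI => //; apply: measurableI.
    by have := emeasurable_fun_infty_c measurableT mf p%:E; rewrite setTI.
  by have := emeasurable_fun_c_infty measurableT mg q%:E; rewrite setTI.
have mC : measurable (F i `\` B) by exact: measurableD.
have split k : measurable_fun setT k -> (forall x, 0 <= k x) ->
    \int[nu]_(x in F i) k x =
    \int[nu]_(x in B) k x + \int[nu]_(x in F i `\` B) k x.
  move=> mk k0; rewrite -ge0_integral_setU//.
  - by rewrite setDUK// BE; exact: subIsetl.
  - exact: measurable_funTS.
  - by rewrite disj_set2E setDIK.
have CfCg : \int[nu]_(x in F i `\` B) f x <= \int[nu]_(x in F i `\` B) g x.
  apply: ae_ge0_le_integral => //; try exact: measurable_funTS.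
  by apply: filterS fg => x fgx _.
have Cfoo : \int[nu]_(x in F i `\` B) f x \is a fin_num.
  rewrite ge0_fin_numE ?integral_ge0//; apply: le_lt_trans (foo i).
  apply: ge0_subset_integral => //; exact: measurable_funTS.
rewrite -(leeD2rE _ _ Cfoo) -split//.
apply: le_trans (gf i); rewrite (split g)//.
exact: leeD2l.
Qed.

Lemma ae_le_cst (mu : {sigma_finite_measure set X -> \bar R}) (h : X -> \bar R) (c : R) :
  (0 <= c)%R -> measurable_fun setT h -> (forall x, 0 <= h x) ->
  (forall A, measurable A -> \int[mu]_(x in A) h x <= c%:E * mu A) ->
  \forall x \ae mu, h x <= c%:E.
Proof.
move=> c0 mh h0 H.
have [F [mF _ UF Foo]] := sigma_finite_trivIset mu.
apply: (@ae_le_of_integral mu (cst c%:E) h F) => // i p q _ B BE.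
have mB : measurable B.
  rewrite BE; apply: measurableI => //; apply: measurableI.
    have mc : measurable_fun [set: X] (cst c%:E) by exact: measurable_cst.
    by have := emeasurable_fun_infty_c measurableT mc p%:E; rewrite setTI.
  by have := emeasurable_fun_c_infty measurableT mh q%:E; rewrite setTI.
by rewrite integral_cst//; exact: H.
Qed.

(** Unification cannot find the measurability of the map from the set function
    [pushforward nu psi], so the measure structure takes it as an argument. *)
Definition pushforward_measure (nu : {measure set X -> \bar R}) (psi : X -> X)
    (mpsi : measurable_fun setT psi) : {measure set X -> \bar R} :=
  measure_function_pushforward__canonical__measure_function_Measure nu mpsi.

(** The theorem of Radon and Nikodym for finite measures applies to the
    restriction of [la] to each piece of the cover; the densities add up. *)
Lemma density_exists (mu : {sigma_finite_measure set X -> \bar R})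
    (la : {measure set X -> \bar R}) (F : (set X)^nat) :
  (forall A, measurable A -> mu A = 0 -> la A = 0) ->
  (forall i, measurable (F i)) -> trivIset setT F -> \bigcup_i F i = setT ->
  (forall i, la (F i) < +oo) ->
  exists h : X -> \bar R, [/\ forall x, 0 <= h x, measurable_fun setT h &
    forall A, measurable A -> la A = \int[mu]_(x in A) h x].
Proof.
move=> lamu mF tF UF Foo.
pose la_ i : {finite_measure set X -> \bar R} := mfrestr (mF i) (Foo i).
have la_mu i : la_ i `<< mu.
  apply/null_content_dominatesP => A mA A0; apply: lamu; first exact: measurableI.
  by apply: (subset_measure0 _ _ _ A0) => //; exact: measurableI.
have [h_ /all_and4[h0 hfin hint hE]] := choice (fun i => radon_nikodym_sigma_finite (la_mu i)).
have mh i : measurable_fun setT (h_ i) by have /integrableP[] := hint i.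
exists (fun x => \sum_(i <oo) h_ i x); split.
- by move=> x; exact: nneseries_ge0.
- exact: ge0_emeasurable_sum.
- move=> A mA; rewrite integral_nneseries//; last first.
    by move=> i; exact: measurable_funTS.
  under eq_eseriesr do rewrite -hE//.
  rewrite -{1}(setIT A) -UF setI_bigcupr measure_bigcup//=.
  + by apply: eq_eseriesl => // i; rewrite in_setT.
  + by move=> i _; exact: measurableI.
  + exact: trivIset_setIl.
Qed.

Lemma ae_densityP (mu nu : {measure set X -> \bar R}) (q : X -> \bar R) :
  measurable_fun setT q -> (forall x, 0 <= q x) ->
  (forall A, measurable A -> nu A = \int[mu]_(x in A) q x) ->
  forall P : X -> Prop,
  (\forall x \ae nu, P x) <-> (\forall x \ae mu, q x != 0 -> P x).
Proof.
move=> mq q0 nuE P; split => -[N [mN N0 PN]].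
- have : \forall x \ae mu, N x -> q x = 0.
    apply: (iffLR (ae_eq_integral_abs mu mN (measurable_funTS mq))).
    by under eq_integral do rewrite gee0_abs//; rewrite -nuE.
  apply: filterS => x Nq qx; apply: contrapT => Px.
  by move/eqP: qx; apply; apply: Nq; apply: PN.
- exists (N `|` [set x | q x = 0]).
  have mq0 : measurable [set x | q x = 0].
    by have := mq measurableT [set 0] (emeasurable_set1 _); rewrite setTI.
  split; first exact: measurableU.
  + have nu0 : nu N + nu [set x | q x = 0] = 0.
      rewrite !nuE// [X in _ + X]integral0_eq// adde0 null_set_integral//.
      exact: measurable_funTS.
    by apply/eqP; rewrite -measure_le0 -[X in _ <= X]nu0; exact: measureU2.
  + move=> x /= nPx; have [->|qx] := eqVneq (q x) 0; first by right.
    by left; apply: PN => /= /(_ qx).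
Qed.

Lemma ae_comp (mu nu : {measure set X -> \bar R}) (psi : X -> X) :
  measurable_fun setT psi ->
  (forall A, measurable A -> mu A = 0 -> nu (psi @^-1` A) = 0) ->
  forall P : X -> Prop, (\forall x \ae mu, P x) -> \forall x \ae nu, P (psi x).
Proof.
move=> mpsi H P [N [mN N0 PN]]; exists (psi @^-1` N); split.
- by rewrite -[X in measurable X]setTI; exact: mpsi.
- exact: H.
- by move=> x /= /PN.
Qed.

End comparison.

(** * Change of variables for a weighted composition *)

Section weighted.
Context d (X : measurableType d) (R : realType).
Variable mu : {sigma_finite_measure set X -> \bar R}.
Local Open Scope ereal_scope.
Implicit Types (psi : X -> X) (u : {mfun X >-> R[i]}).

Lemma measurable_preimageT psi A : measurable_fun setT psi -> measurable A ->
  measurable (psi @^-1` A).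
Proof. by move=> mpsi mA; rewrite -[X in measurable X]setTI; exact: mpsi. Qed.

Lemma measurable_sqr_weight u : measurable_fun setT (fun x => normc (u x) ^+ 2)%R.
Proof. exact: measurable_sqr_normc. Qed.

Lemma wmeas_integral u (f : X -> \bar R) (A : set X) :
  measurable_fun setT f -> (forall x, 0 <= f x) -> measurable A ->
  \int[wmeas mu u]_(x in A) f x =
  \int[mu]_(x in A) (f x * (normc (u x) ^+ 2)%:E).
Proof.
move=> mf f0 mA; apply: (ge0_integral_density (measurable_sqr_weight u)) => //.
by move=> x; exact: sqr_ge0.
Qed.

Lemma ae_wmeasP u (P : X -> Prop) :
  (\forall x \ae wmeas mu u, P x) <-> (\forall x \ae mu, u x != 0 -> P x)%R.
Proof.
have mq : measurable_fun setT (fun x => (normc (u x) ^+ 2)%:E).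
  by apply/measurable_EFinP; exact: measurable_sqr_weight.
have uq x : ((normc (u x) ^+ 2)%:E != 0) = (u x != 0)%R.
  rewrite eqe expf_eq0/=; congr (~~ _); apply/eqP/eqP => [/eq0_normc//|->].
  exact: normc0.
have := @ae_densityP _ _ _ mu (wmeas mu u) _ mq _ _ P.
move=> [||H1 H2]//; first by move=> x; rewrite lee_fin sqr_ge0.
split=> [/H1|H]; first by apply: filterS => x H; rewrite -uq.
by apply: H2; apply: filterS H => x; rewrite uq.
Qed.

Section one_map.
Variables (psi : X -> X) (u : {mfun X >-> R[i]}).
Hypothesis mpsi : measurable_fun setT psi.

(** An image measure below c mu is absolutely continuous and finite wherever mu
    is, so that a derivative exists and is at most c; in particular [wderiv] is
    not the default value of its definition by choice. *)
Lemma wderiv_bounded (c : R) : (0 <= c)%R ->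
  (forall A, measurable A -> wmeas mu u (psi @^-1` A) <= c%:E * mu A) ->
  is_wderiv mu psi u (wderiv mu psi u) /\
  \forall x \ae mu, wderiv mu psi u x <= c%:E.
Proof.
move=> c0 H.
have [F [mF tF UF Foo]] := sigma_finite_trivIset mu.
have la_mu A : measurable A -> mu A = 0 -> pushforward (wmeas mu u) psi A = 0.
  move=> mA A0; apply/eqP; rewrite -measure_le0.
  by apply: (le_trans (H _ mA)); rewrite A0 mule0.
have laoo i : pushforward (wmeas mu u) psi (F i) < +oo.
  by apply: (le_lt_trans (H _ (mF i))); rewrite lte_mul_pinfty ?lee_fin.
have [g [g0 mg gE]] := density_exists la_mu mF tF UF laoo.
have wP : is_wderiv mu psi u (wderiv mu psi u).
  by apply: (@xgetPex _ (cst 0) (is_wderiv mu psi u)); exists g; split.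
have [h0 mh hE] := wP; split => //.
by apply: ae_le_cst => // A mA; rewrite -hE//; exact: H.
Qed.

Variable h : X -> \bar R.
Hypothesis hP : is_wderiv mu psi u h.
Hypothesis hfin : \forall x \ae mu, h x \is a fin_num.

(** Two density formulas meet here, one for |u|^2 mu and one for the image
    measure. The latter is applied to [fine \o h], as h may be infinite on a
    null set. *)
Lemma wderiv_change (f : X -> \bar R) (A : set X) :
  measurable_fun setT f -> (forall x, 0 <= f x) -> measurable A ->
  \int[wmeas mu u]_(x in psi @^-1` A) f (psi x) = \int[mu]_(x in A) (f x * h x).
Proof.
move=> mf f0 mA; have [h0 mh hE] := hP.
have mfh : measurable_fun setT (fine \o h) by exact: measurableT_comp.
have hfine : ae_eq mu setT (fun x => (fine (h x))%:E) h.
  by apply: filterS hfin => x hx _; rewrite fineK.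
transitivity (\int[pushforward (wmeas mu u) psi]_(x in A) f x).
  by rewrite ge0_integral_pushforward//; exact: measurable_funTS.
rewrite (@ge0_integral_density _ _ _ mu _ (fine \o h))//.
- apply: ge0_ae_eq_integral => //.
  + apply: measurable_funTS; apply: emeasurable_funM => //.
    exact/measurable_EFinP.
  + by apply: measurable_funTS; apply: emeasurable_funM.
  + by move=> x _; rewrite mule_ge0// lee_fin fine_ge0.
  + by move=> x _; rewrite mule_ge0.
  + by apply: filterS hfine => x /(_ I) /= ->.
- by move=> x; rewrite fine_ge0.
- move=> B mB; transitivity (\int[mu]_(x in B) h x); first exact: hE.
   apply: ge0_ae_eq_integral => //.
  + exact: measurable_funTS.
  + by apply/measurable_EFinP/measurable_funTS.
  + by move=> x _; rewrite lee_fin fine_ge0.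
  + by apply: filterS hfine => x /(_ I) ->.
Qed.

Lemma wderiv_null A : measurable A -> mu A = 0 -> wmeas mu u (psi @^-1` A) = 0.
Proof.
move=> mA A0; have [h0 mh hE] := hP.
rewrite -[LHS]/(pushforward (wmeas mu u) psi A) hE// null_set_integral//.
exact: measurable_funTS.
Qed.

Lemma wderiv_ae_comp (P : X -> Prop) :
  (\forall x \ae mu, P x) -> \forall x \ae wmeas mu u, P (psi x).
Proof.
by move=> HP; apply: (@ae_comp _ _ _ mu (wmeas mu u) psi mpsi _ P HP) => A; exact: wderiv_null.
Qed.

(** The image measure has no mass where its derivative vanishes. *)
Lemma wderiv_ae_neq0 : \forall x \ae wmeas mu u, h (psi x) != 0.
Proof.
have [h0 mh hE] := hP.
exists (psi @^-1` [set x | h x = 0]).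
have m0 : measurable [set x | h x = 0].
  by have := mh measurableT [set 0] (emeasurable_set1 _); rewrite setTI.
split; first exact: measurable_preimageT.
  by rewrite -[LHS]/(pushforward (wmeas mu u) psi _) hE// integral0_eq.
by move=> x /= /negP; rewrite negbK => /eqP.
Qed.

Lemma wderiv_ae_fin : \forall x \ae wmeas mu u, h (psi x) \is a fin_num.
Proof. exact: wderiv_ae_comp hfin. Qed.

End one_map.

Lemma wprodS (phi : X -> X) (w : X -> R[i]) n x :
  wprod phi w n.+1 x = (wprod phi w n x * w (iter n phi x))%R.
Proof. by rewrite /wprod big_ord_recr. Qed.

Lemma wprodD (phi : X -> X) (w : X -> R[i]) n k x :
  wprod phi w (n + k) x = (wprod phi w n x * wprod phi w k (iter n phi x))%R.
Proof.
elim: k => [|k ih]; first by rewrite addn0 /wprod big_ord0 mulr1.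
by rewrite addnS !wprodS ih mulrA [(n + k)%N]addnC iterD.
Qed.

Lemma wprod0 (phi : X -> X) (w : X -> R[i]) : wprod phi w 0 = cst 1%R.
Proof. by apply/funext => x; rewrite /wprod big_ord0. Qed.

Lemma wprod1 (phi : X -> X) (w : X -> R[i]) : wprod phi w 1 = w.
Proof. by apply/funext => x; rewrite /wprod big_ord1. Qed.

End weighted.

(** * Conditional expectations along a map *)

Section condexp.
Context d (X : measurableType d) (R : realType).
Variable mu : {sigma_finite_measure set X -> \bar R}.
Local Open Scope ereal_scope.

Lemma muleIr (c x y : \bar R) : c \is a fin_num -> c != 0 -> x * c = y * c -> x = y.
Proof.
case: c => [r|//|//] _ r0 /(congr1 (fun z => z * (r^-1)%:E)).
by rewrite -!muleA -EFinM divff ?mule1//; rewrite eqe in r0.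
Qed.

Lemma integral_pushforward_density (nu : {measure set X -> \bar R}) (psi : X -> X)
    (f : X -> \bar R) (F : (set X)^nat) :
  measurable_fun setT psi -> measurable_fun setT f -> (forall x, 0 <= f x) ->
  (forall A, measurable A -> mu A = 0 -> \int[nu]_(x in psi @^-1` A) f x = 0) ->
  (forall i, measurable (F i)) -> trivIset setT F -> \bigcup_i F i = setT ->
  (forall i, \int[nu]_(x in psi @^-1` F i) f x < +oo) ->
  exists rho : X -> \bar R, [/\ forall x, 0 <= rho x, measurable_fun setT rho &
    forall A, measurable A ->
      \int[nu]_(x in psi @^-1` A) f x = \int[mu]_(x in A) rho x].
Proof.
move=> mpsi mf f0 fmu mF tF UF Foo.
pose m A := \int[nu]_(x in A) f x.
have m0 : m set0 = 0 by rewrite /m integral_set0.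
have mge0 A : 0 <= m A by exact: integral_ge0.
have madd : semi_sigma_additive m by exact: semi_sigma_additive_nng_induced.
pose M : {measure set X -> \bar R} := HB.pack m (isMeasure.Build _ _ _ m m0 mge0 madd).
pose la := pushforward_measure M mpsi.
have [rho [rho0 mrho rhoE]] := @density_exists _ _ _ mu la F fmu mF tF UF Foo.
by exists rho; split => // A mA; exact: (rhoE _ mA).
Qed.

Variables (psi : X -> X) (u : {mfun X >-> R[i]}) (h : X -> \bar R) (c : R).
Hypothesis mpsi : measurable_fun setT psi.
Hypothesis hP : is_wderiv mu psi u h.
Hypothesis hfin : \forall x \ae mu, h x \is a fin_num.
Hypothesis Hc : forall A, measurable A -> wmeas mu u (psi @^-1` A) <= c%:E * mu A.

Lemma measurable_condexp f g : is_wcondexp mu psi u f g -> measurable_fun setT g.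
Proof.
move=> [_ Gg _] _ B mB; rewrite setTI; have [C mC <-] := Gg B mB.
by rewrite setTI; exact: measurable_preimageT.
Qed.

(** Level sets of g and g' are preimages under psi, hence sets on which both
    functions have the same integral as f. *)
Lemma condexp_le f g g' : is_wcondexp mu psi u f g -> is_wcondexp mu psi u f g' ->
  \forall x \ae wmeas mu u, g x <= g' x.
Proof.
move=> gP g'P; have mg := measurable_condexp gP; have mg' := measurable_condexp g'P.
move: gP g'P => [g0 Gg gE] [g'0 Gg' g'E].
have mle (p : R) : measurable [set y : \bar R | y <= p%:E].
  by have := emeasurable_itv `]-oo, p%:E]; rewrite set_itvE.
have mge (q : R) : measurable [set y : \bar R | q%:E <= y].
  by have := emeasurable_itv `[q%:E, +oo[; rewrite set_itvE.
have [F [mF _ UF Foo]] := sigma_finite_trivIset mu.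
apply: (@ae_le_of_integral _ _ _ (wmeas mu u) g' g (fun i => psi @^-1` F i)) => //.
- by move=> i; exact: measurable_preimageT.
- by rewrite -preimage_bigcup UF.
- move=> i; apply: (le_lt_trans (Hc (mF i))).
  have c0 : 0 <= c%:E * mu (F i) by apply: le_trans (Hc (mF i)).
  have := Foo i; rewrite -ge0_fin_numE// => Ffin.
  by rewrite ltey_eq fin_numM.
- move=> i p q _ B BE.
  rewrite gE ?g'E//.
    rewrite BE.
    have [C mC CE] := Gg' _ (mle p); have [D mD DE] := Gg _ (mge q).
    exists (F i `&` (C `&` D)); first by do ?apply: measurableI.
    by rewrite -CE -DE !setTI !preimage_setI.
  rewrite BE.
  have [C mC CE] := Gg' _ (mle p); have [D mD DE] := Gg _ (mge q).
  exists (F i `&` (C `&` D)); first by do ?apply: measurableI.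
  by rewrite -CE -DE !setTI !preimage_setI.
Qed.

Lemma condexp_unique f g g' : is_wcondexp mu psi u f g -> is_wcondexp mu psi u f g' ->
  \forall x \ae wmeas mu u, g x = g' x.
Proof.
move=> gP g'P.
apply: filterS2 (condexp_le gP g'P) (condexp_le g'P gP) => x gg' g'g.
by apply/eqP; rewrite eq_le gg'.
Qed.

Variables (f rho : X -> \bar R).
Hypothesis mf : measurable_fun setT f.
Hypothesis mrho : measurable_fun setT rho.
Hypothesis rho0 : forall x, 0 <= rho x.
Hypothesis rhoE : forall A, measurable A ->
  \int[wmeas mu u]_(x in psi @^-1` A) f x = \int[mu]_(x in A) rho x.

(** The function r is rho / h, set to 0 where h vanishes; this is harmless, as
    rho vanishes there too. The existence of a conditional expectation, which
    [wcondexp] presupposes, comes out at the same time. *)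
Lemma condexp_factor : exists r : X -> \bar R,
  [/\ forall x, 0 <= r x, measurable_fun setT r,
      \forall x \ae mu, r x * h x = rho x,
      is_wcondexp mu psi u f (wcondexp mu psi u f) &
      \forall x \ae wmeas mu u, wcondexp mu psi u f x = r (psi x)].
Proof.
have [h0 mh hE] := hP.
pose r y := rho y * (((fine (h y))^-1)%:E).
have r0 y : 0 <= r y by rewrite mule_ge0// lee_fin invr_ge0 fine_ge0.
have mr : measurable_fun setT r.
  apply: emeasurable_funM => //; apply/measurable_EFinP.
  rewrite (_ : (fun y => _) = (fun y => fine (h y) `^ (-1))%R); last first.
    by apply/funext => y; rewrite powR_inv1// fine_ge0.
  apply: (measurableT_comp (measurable_powR (-1))).
  exact: (measurableT_comp (fine_measurable _)).
pose Z := [set x | h x = 0].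
have mZ : measurable Z.
  by have := mh measurableT [set 0] (emeasurable_set1 _); rewrite setTI.
have rhoZ : \forall x \ae mu, Z x -> rho x = 0.
  apply: (iffLR (ae_eq_integral_abs mu mZ (measurable_funTS mrho))).
  under eq_integral do rewrite gee0_abs//.
  rewrite -rhoE//; apply: null_set_integral.
  - exact: measurable_preimageT.
  - exact: measurable_funTS.
  - by rewrite -[LHS]/(pushforward (wmeas mu u) psi Z) hE// integral0_eq.
have rh : \forall x \ae mu, r x * h x = rho x.
  apply: filterS2 rhoZ hfin => x rZ hx.
  have [hx0|hx0] := eqVneq (h x) 0; first by rewrite hx0 mule0 rZ.
  rewrite /r -{2}(fineK hx) -muleA -EFinM mulVf ?mule1//.
  by rewrite fine_eq0.
have rP : is_wcondexp mu psi u f (r \o psi).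
  split; first by move=> x; exact: r0.
    move=> B mB; exists (r @^-1` B); last by rewrite setTI comp_preimage.
    by rewrite -[X in measurable X]setTI; exact: mr.
  move=> _ [A mA <-]; rewrite setTI rhoE// (wderiv_change mpsi hP hfin)//.
  apply: ge0_ae_eq_integral => //.
  - by apply: measurable_funTS; exact: emeasurable_funM.
  - exact: measurable_funTS.
  - by move=> x _; exact: mule_ge0.
  - by apply: filterS rh => x ->.
have eP : is_wcondexp mu psi u f (wcondexp mu psi u f).
  by apply: (@xgetPex _ (cst 0) (is_wcondexp mu psi u f)); exists (r \o psi).
by exists r; split => //; exact: condexp_unique rP.
Qed.

(** Multiplying by h o psi, which is finite and nonzero almost everywhere, clears
    the denominator of rho / h. *)
Lemma condexp_fixP : (\forall x \ae wmeas mu u, f x = wcondexp mu psi u f x) <->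
  (\forall x \ae wmeas mu u, rho (psi x) = f x * h (psi x)).
Proof.
have [r [_ _ /(wderiv_ae_comp mpsi hP) rh _ er]] := condexp_factor.
split=> H.
  by apply: filterS3 H rh er => x -> <- ->.
have hn0 := wderiv_ae_neq0 mpsi hP; have hf := wderiv_ae_fin mpsi hP hfin.
near=> x; apply: (@muleIr (h (psi x))).
- by near: x.
- by near: x.
- have -> : wcondexp mu psi u f x = r (psi x) by near: x.
  have -> : r (psi x) * h (psi x) = rho (psi x) by near: x.
  by apply/esym; near: x.
Unshelve. all: by end_near. Qed.

End condexp.

(** * The measures and derivatives of the iterates *)

Section iterates_def.
Context d (X : measurableType d) (R : realType).
Variables (mu : {sigma_finite_measure set X -> \bar R}) (phi : {mfun X >-> X})
  (w : {mfun X >-> R[i]}).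

Definition nu_iter n : {measure set X -> \bar R} := wmeas mu (wprod phi w n).

Definition h_iter n : X -> \bar R := wderiv mu (iter n phi) (wprod phi w n).

(** The equation h_n = E_k(h_n) with its denominator cleared. *)
Definition factorises n k := \forall x \ae nu_iter k,
  h_iter (n + k) (iter k phi x) = (h_iter n x * h_iter k (iter k phi x))%E.

End iterates_def.

Section iterates.
Context d (X : measurableType d) (R : realType).
Variables (mu : {sigma_finite_measure set X -> \bar R}) (phi : {mfun X >-> X})
  (w : {mfun X >-> R[i]}) (K : R).
Hypothesis K0 : 0 <= K.
Local Open Scope ereal_scope.
Hypothesis HK : forall A, measurable A -> wmeas mu w (phi @^-1` A) <= K%:E * mu A.

Local Notation nu := (nu_iter mu phi w).
Local Notation h := (h_iter mu phi w).

Lemma preimage_iterD n k (A : set X) :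
  iter (n + k) phi @^-1` A = iter n phi @^-1` (iter k phi @^-1` A).
Proof. by apply/funext => x; rewrite /preimage/= addnC iterD. Qed.

Lemma measurable_preimage_iter n A : measurable A -> measurable (iter n phi @^-1` A).
Proof. exact: measurable_preimageT (measurable_iter phi n). Qed.

Lemma nu_iter0 A : measurable A -> nu 0%N A = mu A.
Proof.
move=> mA; rewrite /nu_iter/= /wmeas; under eq_integral do rewrite wprod0.
rewrite (_ : (fun x : X => _) = cst 1) ?integral_cst ?mul1e//.
by apply/funext => x; rewrite [normc _](normc1 R) expr1n.
Qed.

(** Change of variables along phi^n for the weight w_(n+k), which is the product
    of w_n and w_k o phi^n. *)
Lemma nu_iter_transfer n k (f : X -> \bar R) (B : set X) :
  is_wderiv mu (iter n phi) (wprod phi w n) (h n) ->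
  (\forall x \ae mu, h n x \is a fin_num) ->
  measurable_fun setT f -> (forall x, 0 <= f x) -> measurable B ->
  \int[nu (n + k)]_(x in iter n phi @^-1` B) f (iter n phi x) =
  \int[nu k]_(x in B) (f x * h n x).
Proof.
move=> hP hfin mf f0 mB; have [h0 mh _] := hP.
have mq m : measurable_fun setT (fun x => (normc (wprod phi w m x) ^+ 2)%:E).
  by apply/measurable_EFinP; exact: measurable_sqr_normc (measurable_wprod phi w m).
have q0 m x : 0 <= (normc (wprod phi w m x) ^+ 2)%:E by rewrite lee_fin sqr_ge0.
rewrite !wmeas_integral//; last first.
- exact: measurable_preimage_iter.
- exact: measurableT_comp (measurable_iter phi n).
- by move=> x; rewrite mule_ge0.
- exact: emeasurable_funM.
pose g x := f x * (normc (wprod phi w k x) ^+ 2)%:E.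
have mg : measurable_fun setT g by exact: emeasurable_funM.
have g0 x : 0 <= g x by exact: mule_ge0.
transitivity (\int[wmeas mu (wprod phi w n)]_(x in iter n phi @^-1` B) g (iter n phi x)).
  rewrite wmeas_integral//; last 2 first.
  - exact: measurableT_comp (measurable_iter phi n).
  - exact: measurable_preimage_iter.
  apply: eq_integral => x _.
  by rewrite /g /= wprodD normcM exprMn EFinM -muleA [X in _ * X]muleC.
rewrite (wderiv_change (measurable_iter phi n) hP hfin)//.
by apply: eq_integral => x _; rewrite /g -!muleA [X in _ * X]muleC.
Qed.

Lemma h_iter_one : h 1 = wderiv mu phi w.
Proof. by rewrite /h_iter wprod1. Qed.

Lemma nu_iter_one : nu 1 = wmeas mu w :> (set X -> \bar R).
Proof. by rewrite /nu_iter/= wprod1. Qed.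

Lemma ae_fin_num (h' : X -> \bar R) (c : R) :
  (forall x, 0 <= h' x) -> (\forall x \ae mu, h' x <= c%:E) ->
  \forall x \ae mu, h' x \is a fin_num.
Proof.
move=> h'0; apply: filterS => x hc; rewrite ge0_fin_numE//.
by apply: (le_lt_trans hc); rewrite ltry.
Qed.

Lemma ae_nu_iter n (P : X -> Prop) : (\forall x \ae mu, P x) -> \forall x \ae nu n, P x.
Proof. by move=> H; apply/ae_wmeasP; apply: filterS H. Qed.

(** The bound propagates because nu_(n+1) (phi^-(n+1) A) is the integral of h_1
    over phi^-n A for nu_n. *)
Lemma h_iterP n : [/\ is_wderiv mu (iter n phi) (wprod phi w n) (h n),
  \forall x \ae mu, h n x <= (K ^+ n)%:E &
  forall A, measurable A -> nu n (iter n phi @^-1` A) <= (K ^+ n)%:E * mu A].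
Proof.
suff H : forall A, measurable A -> nu n (iter n phi @^-1` A) <= (K ^+ n)%:E * mu A.
  by have [] := wderiv_bounded (measurable_iter phi n) (exprn_ge0 n K0) H.
have [h1P h1K] : is_wderiv mu (iter 1 phi) (wprod phi w 1) (h 1) /\
    \forall x \ae mu, h 1 x <= K%:E.
  by rewrite /h_iter wprod1; exact: (wderiv_bounded (measurable_iter phi 1) K0 HK).
have [h0 mh _] := h1P.
elim: n => [A mA|n ih A mA]; first by rewrite expr0 mul1e nu_iter0.
have mB := measurable_preimage_iter n mA.
have -> : nu n.+1 (iter n.+1 phi @^-1` A) =
    \int[nu n]_(x in iter n phi @^-1` A) (1 * h 1 x).
  rewrite -(nu_iter_transfer (f := cst 1) n h1P)//; last exact: ae_fin_num h1K.
  by rewrite integral_cst ?mul1e// -?preimage_iterD//; exact: measurable_preimage_iter.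
under eq_integral do rewrite mul1e.
apply: (@le_trans _ _ (\int[nu n]_(x in iter n phi @^-1` A) cst K%:E x)).
  apply: ae_ge0_le_integral => //.
  - exact: measurable_funTS.
  - by have := ae_nu_iter n h1K; apply: filterS => x hx _.
rewrite integral_cst// exprS EFinM -muleA; apply: lee_wpmul2l; rewrite ?lee_fin//; exact: ih.
Qed.

Lemma h_iter_ge0 n x : 0 <= h n x.
Proof. by have [[]] := h_iterP n. Qed.

Lemma measurable_h_iter n : measurable_fun setT (h n).
Proof. by have [[]] := h_iterP n. Qed.

Lemma h_iter_fin n : \forall x \ae mu, h n x \is a fin_num.
Proof.
by have [_ hK _] := h_iterP n; exact: ae_fin_num (h_iter_ge0 n) hK.
Qed.

Let hP n : is_wderiv mu (iter n phi) (wprod phi w n) (h n).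
Proof. by have [] := h_iterP n. Qed.

Let mh := measurable_h_iter.
Let h0 := h_iter_ge0.
Hint Resolve mh h0 : core.

Lemma nu_iter_preimage_lty n A : measurable A -> mu A < +oo -> nu n (iter n phi @^-1` A) < +oo.
Proof.
move=> mA Aoo; have [_ _ H] := h_iterP n; apply: le_lt_trans (H _ mA) _.
by rewrite lte_mul_pinfty// lee_fin exprn_ge0.
Qed.

Lemma h_iter_neq0 n : \forall x \ae nu n, h n (iter n phi x) != 0.
Proof. exact: (wderiv_ae_neq0 (measurable_iter phi n) (hP n)). Qed.

Lemma ae_comp_iter n k (P : X -> Prop) :
  (\forall x \ae nu k, P x) -> \forall x \ae nu (n + k), P (iter n phi x).
Proof.
apply: ae_comp; first exact: measurable_iter.
move=> A mA A0; rewrite -(mul1e (nu _ _)) -integral_cst//; last exact: measurable_preimage_iter.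
rewrite (nu_iter_transfer (f := cst 1) k (hP n))//; last exact: h_iter_fin.
by apply: null_set_integral => //; apply: measurable_funTS; exact: emeasurable_funM.
Qed.

Lemma ae_comp_iter_mu n (P : X -> Prop) :
  (\forall x \ae mu, P x) -> \forall x \ae nu n, P (iter n phi x).
Proof.
by move=> /(ae_nu_iter 0) /(ae_comp_iter n); rewrite addn0.
Qed.

Lemma ae_nu_iterD n k (P : X -> Prop) :
  (\forall x \ae nu n, P x) -> \forall x \ae nu (n + k), P x.
Proof.
move=> /ae_wmeasP H; apply/ae_wmeasP; apply: filterS H => x H.
by rewrite /= wprodD mulf_eq0 negb_or => /andP[/H].
Qed.

(** The image of nu_(n+k) under phi^n is h_n nu_k, so that statements about
    phi^n x can be pulled back to x exactly where h_n does not vanish. *)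
Lemma ae_comp_iter_inv n k (P : X -> Prop) : measurable [set x | P x] ->
  (\forall x \ae nu (n + k), P (iter n phi x)) ->
  \forall x \ae nu k, h n x != 0 -> P x.
Proof.
move=> mP H; pose N := ~` [set x | P x].
have mN : measurable N by exact: measurableC.
have N0 : \int[nu k]_(x in N) h n x = 0.
  transitivity (\int[nu k]_(x in N) (1 * h n x)).
    by under [RHS]eq_integral do rewrite mul1e.
  rewrite -(nu_iter_transfer (f := cst 1) k (hP n))//; last exact: h_iter_fin.
  rewrite integral_cst ?mul1e; last exact: measurable_preimage_iter.
  by apply: measure_negligible => //; exact: measurable_preimage_iter.
have : \forall x \ae nu k, N x -> h n x = 0.
  apply: (iffLR (ae_eq_integral_abs (nu k) mN (measurable_funTS (mh n)))).
  by under eq_integral do rewrite gee0_abs//.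
by apply: filterS => x Nx hx; apply: contrapT => Px; move/eqP: hx; apply; exact: Nx.
Qed.

(** Both sides are the integral of g o phi^(n+k) for nu_(n+k). *)
Lemma integral_h_iter n k (g : X -> \bar R) A :
  measurable_fun setT g -> (forall x, 0 <= g x) -> measurable A ->
  \int[nu k]_(x in iter k phi @^-1` A) (g (iter k phi x) * h n x) =
  \int[mu]_(x in A) (g x * h (n + k) x).
Proof.
move=> mg g0 mA.
rewrite -(nu_iter_transfer (f := g \o iter k phi) k (hP n) (h_iter_fin n))//.
- rewrite -(wderiv_change (measurable_iter phi (n + k)) (hP (n + k)) (h_iter_fin _))//.
  by rewrite preimage_iterD; apply: eq_integral => x _; rewrite /= -iterD addnC.
- exact: measurableT_comp (measurable_iter phi k).
- by move=> x; exact: g0.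
- exact: measurable_preimage_iter.
Qed.

Lemma integral_h_iter1 n k A : measurable A ->
  \int[nu k]_(x in iter k phi @^-1` A) h n x = \int[mu]_(x in A) h (n + k) x.
Proof.
move=> mA; have := @integral_h_iter n k (cst 1) A; under eq_integral do rewrite mul1e.
by under [in RHS]eq_integral do rewrite mul1e; apply.
Qed.

Local Notation fact := (factorises mu phi w).

Lemma condexp_h_iter_fixP n k : fact n k <->
  \forall x \ae nu k, h n x = wcondexp mu (iter k phi) (wprod phi w k) (h n) x.
Proof.
have [_ _ Hc] := h_iterP k.
rewrite (condexp_fixP (measurable_iter phi k) (hP k) (h_iter_fin k) Hc (mh n)
  (mh (n + k)) (h0 (n + k)))//.
by move=> A mA; exact: integral_h_iter1.
Qed.

(** Composing the relations (n + k, 1) and (k, 1) with phi^k turns the relation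
    (n, k) into (n, k + 1). *)
Lemma factorises_all : (forall n, (0 < n)%N -> fact n 1) ->
  forall n k, (0 < n)%N -> (0 < k)%N -> fact n k.
Proof.
move=> H n k n0; elim: k => // -[_ _|k /(_ isT) ih _]; first exact: H.
have H1 := ae_comp_iter k.+1 (H _ (ltn_addr k.+1 n0)).
have H2 := ae_comp_iter k.+1 (H k.+1 isT).
have H3 := ae_nu_iterD 1 ih.
rewrite /factorises -[k.+2]addn1 addnA.
apply: filterS3 H1 H2 H3 => x E1 E2 E3.
have -> : iter (k.+1 + 1) phi x = iter 1 phi (iter k.+1 phi x).
  by rewrite [(k.+1 + 1)%N]addnC iterD.
by rewrite E1 E2 E3 muleA.
Qed.

Lemma prod_h_iter_recl n x :
  \prod_(1 <= j < n.+2) h 1 (iter j phi x) =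
  h 1 (phi x) * \prod_(1 <= j < n.+1) h 1 (iter j phi (phi x)).
Proof.
rewrite big_nat_recl//; congr (_ * _).
by apply: eq_bigr => j _; rewrite -iterSr.
Qed.

Definition derivative_product n := \forall x \ae nu n,
  \prod_(1 <= j < n.+1) h 1 (iter j phi x) = h n (iter n phi x).

(** Composing the relation (1, n) with phi adds the factor h_1 o phi to the
    product formula at n composed with phi. *)
Lemma factorises_product : (forall n, (0 < n)%N -> fact 1 n) ->
  forall n, (0 < n)%N -> derivative_product n.
Proof.
move=> H; elim=> // -[_ _|n /(_ isT) ih _].
  by apply: aeW => x; rewrite big_nat1.
have H1 := ae_comp_iter 1 (H n.+1 isT).
have H2 := ae_comp_iter 1 ih.
apply: filterS2 H1 H2 => x; rewrite add1n => H1 H2.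
by rewrite prod_h_iter_recl H2 -!iterSr in H1 *; rewrite H1.
Qed.

(** The product formulas at n and n + 1 give the relation (n, 1) after
    composition with phi^n, that is, where h_n does not vanish. Elsewhere
    its right-hand side is 0, so an inequality holds everywhere, and equality
    follows as both sides have the same finite integrals. *)
Lemma product_factorises : (forall n, (0 < n)%N -> derivative_product n) ->
  forall n, (0 < n)%N -> fact n 1.
Proof.
move=> H n n0.
pose f x := h n x * h 1 (phi x); pose g x := h (n + 1) (phi x).
have mhphi m : measurable_fun setT (fun x => h m (phi x)).
  exact: (measurableT_comp (mh m) (measurable_iter phi 1)).
have mf : measurable_fun setT f by apply: emeasurable_funM.
have f0 x : 0 <= f x by rewrite mule_ge0.
have g0 x : 0 <= g x by exact: h0.
have mfg : measurable [set x | g x = f x].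
  by have := measurable_eqe measurableT (mhphi (n + 1)%N) mf; rewrite setTI.
have H1 : \forall x \ae nu (n + 1), g (iter n phi x) = f (iter n phi x).
  have H1 := H _ (ltn_addr 1 n0); have H2 := ae_nu_iterD 1 (H _ n0).
  apply: filterS2 H1 H2 => x; rewrite addn1 big_nat_recr// => {}H1 {}H2.
  by rewrite /g addn1 -iterS -H1 H2.
have {}H1 := ae_comp_iter_inv mfg H1.
have fg : \forall x \ae nu 1, f x <= g x.
  apply: filterS H1 => x H1; have [hx|/H1 ->//] := eqVneq (h n x) 0.
  by rewrite /f hx mul0e.
have [F [mF _ UF Foo]] := sigma_finite_trivIset mu.
have fE A : measurable A -> \int[nu 1]_(x in iter 1 phi @^-1` A) f x =
    \int[mu]_(x in A) (h 1 x * h (n + 1) x).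
  by move=> mA; rewrite -integral_h_iter//; apply: eq_integral => x _; rewrite muleC.
have gE A : measurable A -> \int[nu 1]_(x in iter 1 phi @^-1` A) g x =
    \int[mu]_(x in A) (h 1 x * h (n + 1) x).
  move=> mA.
  have := wderiv_change (measurable_iter phi 1) (hP 1) (h_iter_fin 1)
    (mh (n + 1)%N) (h0 (n + 1)%N) mA.
  by under [X in _ = X -> _]eq_integral do rewrite muleC; apply: etrans.
have gf : \forall x \ae nu 1, g x <= f x.
  apply: (ae_ge_of_integral mf (mhphi (n + 1)%N) f0 g0
    (F := fun i => iter 1 phi @^-1` F i)) => //.
  - by move=> i; exact: measurable_preimage_iter.
  - by rewrite -preimage_bigcup UF.
  - by move=> i; exact: nu_iter_preimage_lty.
  - move=> i; rewrite fE//.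
    have [_ h1K _] := h_iterP 1; have [_ hnK _] := h_iterP (n + 1).
    apply: (@le_lt_trans _ _ (\int[mu]_(x in F i) cst (K ^+ 1 * K ^+ (n + 1))%:E x)).
      apply: ae_ge0_le_integral => //.
      + by move=> x _; exact: mule_ge0.
      + by apply: measurable_funTS; exact: emeasurable_funM.
      + by move=> x _; rewrite lee_fin mulr_ge0// exprn_ge0.
      + by apply: filterS2 h1K hnK => x h1 h2 _; rewrite /= EFinM lee_pmul.
    rewrite integral_cst//; apply: lte_mul_pinfty => //.
      by rewrite lee_fin mulr_ge0// exprn_ge0.
    exact: Foo.
  - by move=> i; rewrite gE// fE.
rewrite /factorises; apply: filterS2 fg gf => x fg gf.
by apply/eqP; rewrite eq_le gf fg.
Qed.

End iterates.

(** * Second moments of the first derivative *)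

Section conditionG.
Context d (X : measurableType d) (R : realType).
Variables (mu : {sigma_finite_measure set X -> \bar R}) (phi : {mfun X >-> X})
  (w : {mfun X >-> R[i]}) (K : R).
Hypothesis K0 : 0 <= K.
Local Open Scope ereal_scope.
Hypothesis HK : forall A, measurable A -> wmeas mu w (phi @^-1` A) <= K%:E * mu A.

Local Notation nu := (nu_iter mu phi w).
Local Notation h := (h_iter mu phi w).
Local Notation fact := (factorises mu phi w).
Local Notation E n f := (wcondexp mu (iter n phi) (wprod phi w n) f).

Let hP n : is_wderiv mu (iter n phi) (wprod phi w n) (h n).
Proof. by have [] := h_iterP K0 HK n. Qed.

Let Hc n A : measurable A -> nu n (iter n phi @^-1` A) <= (K ^+ n)%:E * mu A.
Proof. by have [_ _] := h_iterP K0 HK n; apply. Qed.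

Let mh n : measurable_fun setT (h n) := measurable_h_iter K0 HK n.
Let h0 n x : 0 <= h n x := h_iter_ge0 K0 HK n x.

(** Condition (G) at n. *)
Definition condexp_shift n := \forall x \ae nu n.+1,
  E n (h 1) (phi x) = E n.+1 (h 1 \o phi) x.

(** When h_1 = E_n(h_1), the function E_n(h_1) o phi has the defining properties
    of E_(n+1)(h_1 o phi): it depends on phi^(n+1) only and has the same
    integrals as h_1 o phi. *)
Lemma factorises_condexp_shift n : fact 1 n -> condexp_shift n.
Proof.
move=> /(condexp_h_iter_fixP K0 HK) H1.
have [r [_ _ _ aP0 _]] := condexp_factor (measurable_iter phi n) (hP n) (h_iter_fin K0 HK n)
   (Hc n) (mh 1%N) (mh (1 + n)%N) (h0 (1 + n)%N) (integral_h_iter1 K0 HK 1 n).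
have ma := measurable_condexp (measurable_iter phi n) aP0; have [a0 Ga aE] := aP0.
have H2 := ae_comp_iter K0 HK 1 H1.
have aP : is_wcondexp mu (iter n.+1 phi) (wprod phi w n.+1) (h 1 \o phi) (E n (h 1) \o phi).
  split.
  - by move=> x; exact: a0.
  - move=> B mB; have [C mC CE] := Ga B mB; exists C => //.
    rewrite setTI -[n.+1]add1n preimage_iterD -[in RHS]comp_preimage.
    by rewrite setTI in CE; rewrite CE.
  - move=> _ [A mA <-]; rewrite setTI.
    have mpA := measurable_preimage_iter phi n.+1 mA.
    apply: ge0_ae_eq_integral => //.
    + by apply: measurable_funTS; exact: (measurableT_comp ma (measurable_iter phi 1)).
    + by apply: measurable_funTS; exact: (measurableT_comp (mh 1%N) (measurable_iter phi 1)).
    + by move=> x _; exact: a0.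
    + by move=> x _; exact: h0.
    + by move: H2; apply: filterS => x /= -> _.
have eP : is_wcondexp mu (iter n.+1 phi) (wprod phi w n.+1) (h 1 \o phi) (E n.+1 (h 1 \o phi)).
  by apply: (@xgetPex _ (cst 0) (is_wcondexp mu _ _ _)); eexists; exact: aP.
exact: (condexp_unique (measurable_iter phi n.+1) (@Hc n.+1) aP eP).
Qed.

(** Let r o phi^n = E_n(h_1). Over phi^-n A and for nu_n, the hypothesis says
    that (r o phi^n) h_1 and h_1^2 have the same integral, and so does
    (r o phi^n)^2 because r o phi^n depends on phi^n only. The square of
    h_1 - r o phi^n therefore has integral 0. *)
Lemma condexp_shift_factorises n : condexp_shift n -> fact 1 n.
Proof.
move=> G.
have hfin := h_iter_fin K0 HK.
have [r [r0 mr rh _ ar]] := condexp_factor (measurable_iter phi n) (hP n) (hfin n)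
   (Hc n) (mh 1%N) (mh (1 + n)%N) (h0 (1 + n)%N) (integral_h_iter1 K0 HK 1 n).
have mhphi : measurable_fun setT (h 1 \o phi).
  exact: (measurableT_comp (mh 1%N) (measurable_iter phi 1)).
have [F [mF tF UF Foo]] := sigma_finite_trivIset mu.
pose rn x := r (iter n phi x).
have mrn : measurable_fun setT rn by exact: (measurableT_comp mr (measurable_iter phi n)).
have rn0 x : 0 <= rn x by exact: r0.
have h1K : \forall x \ae nu n, h 1 x <= K%:E.
  by have [_ h1K _] := h_iterP K0 HK 1; apply: (ae_nu_iter phi w n); rewrite expr1 in h1K.
have sq A : measurable A ->
    \int[nu n.+1]_(x in iter n.+1 phi @^-1` A) (h 1 \o phi) x =
    \int[nu n]_(x in iter n phi @^-1` A) (h 1 x * h 1 x).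
  move=> mA; have := nu_iter_transfer n (hP 1%N) (hfin 1%N) (mh 1%N) (h0 1%N)
    (measurable_preimage_iter phi n mA).
  by rewrite -preimage_iterD.
have sqoo i : \int[nu n]_(x in iter n phi @^-1` F i) (h 1 x * h 1 x) < +oo.
  apply: (@le_lt_trans _ _ (\int[nu n]_(x in iter n phi @^-1` F i) cst (K * K)%:E x)).
    apply: ae_ge0_le_integral => //.
    + exact: measurable_preimage_iter.
    + by move=> x _; rewrite mule_ge0.
    + by apply: measurable_funTS; exact: emeasurable_funM.
    + by move=> x _; rewrite lee_fin mulr_ge0.
    + by apply: filterS h1K => x h1 _; rewrite /= EFinM lee_pmul.
  rewrite integral_cst; last exact: measurable_preimage_iter.
  apply: lte_mul_pinfty => //; first by rewrite lee_fin mulr_ge0.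
  exact: (nu_iter_preimage_lty K0 HK).
have [rho [rho0 mrho rhoE]] : exists rho : X -> \bar R, [/\ forall x, 0 <= rho x,
    measurable_fun setT rho & forall A, measurable A ->
    \int[nu n.+1]_(x in iter n.+1 phi @^-1` A) (h 1 \o phi) x = \int[mu]_(x in A) rho x].
  apply: (integral_pushforward_density (measurable_iter phi n.+1) mhphi _ _ mF tF UF).
  - by move=> x; exact: h0.
  - move=> A mA A0; apply: null_set_integral.
    + exact: measurable_preimage_iter.
    + exact: measurable_funTS.
    + exact: (wderiv_null (hP n.+1)).
  - by move=> i; rewrite sq.
have [_ [_ _ _ eP _]] := condexp_factor (measurable_iter phi n.+1) (hP n.+1) (hfin n.+1)
   (@Hc n.+1) mhphi mrho rho0 rhoE.
have me := measurable_condexp (measurable_iter phi n.+1) eP; have [e0 Ge eE] := eP.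
have er : \forall x \ae nu n.+1, E n.+1 (h 1 \o phi) x = rn (phi x).
  have := ae_comp_iter K0 HK 1 ar; apply: filterS2 G => x <-; apply.
have rnh A : measurable A -> \int[nu n]_(x in iter n phi @^-1` A) (rn x * h 1 x) =
    \int[nu n]_(x in iter n phi @^-1` A) (h 1 x * h 1 x).
  move=> mA.
  have GA : preimage_set_system setT (iter n.+1 phi) measurable (iter n.+1 phi @^-1` A).
    by exists A => //; rewrite setTI.
  apply: (etrans _ (sq A mA)); apply: (etrans _ (eE _ GA)).
  have := nu_iter_transfer n (hP 1%N) (hfin 1%N) mrn rn0 (measurable_preimage_iter phi n mA).
  rewrite -preimage_iterD => <-.
  apply: ge0_ae_eq_integral => //.
  - exact: measurable_preimage_iter.
  - by apply: measurable_funTS; exact: (measurableT_comp mrn (measurable_iter phi 1)).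
  - exact: measurable_funTS.
  - by move: er; apply: filterS => x -> _.
have rnrn A : measurable A -> \int[nu n]_(x in iter n phi @^-1` A) (rn x * rn x) =
    \int[nu n]_(x in iter n phi @^-1` A) (h 1 x * h 1 x).
  move=> mA; rewrite -rnh// (integral_h_iter K0 HK)//.
  have mrr : measurable_fun setT (fun x => r x * r x) by exact: emeasurable_funM.
  have rr0 x : 0 <= r x * r x by exact: mule_ge0.
  apply: (etrans (wderiv_change (measurable_iter phi n) (hP n) (hfin n) mrr rr0 mA)).
  apply: ge0_ae_eq_integral => //.
  - by apply: measurable_funTS; do ?apply: emeasurable_funM.
  - by apply: measurable_funTS; exact: emeasurable_funM.
  - by move=> x _; rewrite mule_ge0.
  - by move=> x _; rewrite mule_ge0.
  - by apply: filterS rh => x <- _; rewrite muleA.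
have mhh : measurable_fun setT (fun x => h 1 x * h 1 x) by exact: emeasurable_funM.
have mrr : measurable_fun setT (fun x => rn x * rn x) by exact: emeasurable_funM.
have mrnh : measurable_fun setT (fun x => rn x * h 1 x) by exact: emeasurable_funM.
pose f x := rn x * h 1 x + rn x * h 1 x.
pose g x := rn x * rn x + h 1 x * h 1 x.
have mf : measurable_fun setT f by exact: emeasurable_funD.
have mg : measurable_fun setT g by exact: emeasurable_funD.
have f0 x : 0 <= f x by rewrite adde_ge0// mule_ge0.
have g0 x : 0 <= g x by rewrite adde_ge0// mule_ge0.
have rnfin : \forall x \ae nu n, rn x \is a fin_num.
  have H1 := ae_comp_iter_mu K0 HK n rh.
  have H2 := ae_comp_iter_mu K0 HK n (hfin (1 + n)%N).
  have H3 := h_iter_neq0 K0 HK n.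
  apply: filterS3 H1 H2 H3 => x H1 H2 H3.
  rewrite ge0_fin_numE// ltey; apply/eqP => rnoo; move: H2.
  by rewrite -H1 -/(rn x) rnoo gt0_mulye// lt0e H3/=.
have h1fin := ae_nu_iter phi w n (hfin 1%N).
have fg : \forall x \ae nu n, f x <= g x.
  apply: filterS2 rnfin h1fin => x; rewrite /f /g.
  case: (rn x) (h 1 x) => [a||] [b||]// _ _.
  rewrite -!EFinM -!EFinD lee_fin -subr_ge0.
  by rewrite (_ : _ - _ = (a - b) ^+ 2)%R ?sqr_ge0//; ring.
have fE A : measurable A -> \int[nu n]_(x in iter n phi @^-1` A) f x =
    \int[nu n]_(x in iter n phi @^-1` A) (h 1 x * h 1 x) +
    \int[nu n]_(x in iter n phi @^-1` A) (h 1 x * h 1 x).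
  move=> mA; rewrite ge0_integralD//; first by rewrite rnh.
  - exact: measurable_preimage_iter.
  - by move=> x _; exact: mule_ge0.
  - exact: measurable_funTS.
  - by move=> x _; exact: mule_ge0.
  - exact: measurable_funTS.
have gE A : measurable A -> \int[nu n]_(x in iter n phi @^-1` A) g x =
    \int[nu n]_(x in iter n phi @^-1` A) (h 1 x * h 1 x) +
    \int[nu n]_(x in iter n phi @^-1` A) (h 1 x * h 1 x).
  move=> mA; rewrite ge0_integralD//; first by rewrite rnrn.
  - exact: measurable_preimage_iter.
  - by move=> x _; exact: mule_ge0.
  - exact: measurable_funTS.
  - by move=> x _; exact: mule_ge0.
  - exact: measurable_funTS.
(* the arithmetic-geometric inequality f <= g holds, with equal integrals *)
have gf : \forall x \ae nu n, g x <= f x.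
  apply: (ae_ge_of_integral mf mg f0 g0
    (F := fun i => iter n phi @^-1` F i)) => //.
  - by move=> i; exact: measurable_preimage_iter.
  - by rewrite -preimage_bigcup UF.
  - by move=> i; exact: (nu_iter_preimage_lty K0 HK).
  - by move=> i; rewrite fE// lte_add_pinfty.
  - by move=> i; rewrite gE// fE.
have hr : \forall x \ae nu n, h 1 x = rn x.
  apply: filterS3 rnfin h1fin gf => x; rewrite /f /g.
  case: (rn x) (h 1 x) => [a||] [b||]// _ _.
  rewrite -!EFinM -!EFinD lee_fin => gf; congr EFin.
  apply/eqP; rewrite eq_sym -subr_eq0 -sqrf_eq0 eq_le sqr_ge0 andbT.
  rewrite -subr_ge0 in gf; rewrite -oppr_ge0.
  by rewrite (_ : - _ = a * b + a * b - (a * a + b * b))%R//; ring.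
apply/(condexp_h_iter_fixP K0 HK).
by apply: filterS2 hr ar => x -> ->.
Qed.

End conditionG.

(** * Square integrable real functions *)

Section real_L2.
Context d (X : measurableType d) (R : realType).
Variable mu : {measure set X -> \bar R}.

Definition sqint (f : X -> R) :=
  measurable_fun setT f /\ (\int[mu]_x ((f x ^+ 2)%:E) < +oo)%E.

Lemma sqintM_integrable f g : sqint f -> sqint g ->
  mu.-integrable setT (fun x => (f x * g x)%:E).
Proof.
move=> [mf foo] [mg goo].
have mf2 : measurable_fun setT (fun x => (f x ^+ 2)%:E).
  by apply/measurable_EFinP; exact: measurable_funX.
have mg2 : measurable_fun setT (fun x => (g x ^+ 2)%:E).
  by apply/measurable_EFinP; exact: measurable_funX.
have i2 k : measurable_fun setT (fun x => (k x ^+ 2)%:E) ->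
    (\int[mu]_x ((k x ^+ 2)%:E) < +oo)%E -> mu.-integrable setT (fun x => (k x ^+ 2)%:E).
  move=> mk koo; apply/integrableP; split => //.
  by under eq_integral do rewrite gee0_abs ?lee_fin ?sqr_ge0//.
apply: (@le_integrable _ _ _ _ _ measurableT _ (fun x => (f x ^+ 2)%:E + (g x ^+ 2)%:E)%E).
- by apply/measurable_EFinP; exact: measurable_funM.
- move=> x _ /=; rewrite lee_fin [leRHS]ger0_norm ?addr_ge0 ?sqr_ge0//.
  rewrite normrM -(real_normK (num_real (f x))) -(real_normK (num_real (g x))).
  move: `|f x| `|g x| (normr_ge0 (f x)) (normr_ge0 (g x)) => a b a0 b0.
  rewrite -subr_ge0; have := sqr_ge0 (a - b); have := mulr_ge0 a0 b0.
  by rewrite sqrrB; lra.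
- by apply: integrableD => //; exact: i2.
Qed.

Lemma sqint_le (f g : X -> R) : measurable_fun setT f -> sqint g ->
  (forall x, `|f x| <= `|g x|) -> sqint f.
Proof.
move=> mf [mg goo] fg; split => //; apply: le_lt_trans goo.
apply: ge0_le_integral => //.
- by move=> x _; rewrite lee_fin sqr_ge0.
- by apply/measurable_EFinP; exact: measurable_funX.
- by apply/measurable_EFinP; exact: measurable_funX.
- move=> x _; rewrite lee_fin -(real_normK (num_real (f x))).
  by rewrite -(real_normK (num_real (g x))) ler_pXn2r ?nnegrE.
Qed.

Lemma sqintD f g : sqint f -> sqint g -> sqint (f \+ g).
Proof.
move=> sf sg; have [mf foo] := sf; have [mg goo] := sg.
have mD : measurable_fun setT (f \+ g) by exact: measurable_funD.
split => //.
have mf2 : measurable_fun setT (fun x => (f x ^+ 2)%:E).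
  by apply/measurable_EFinP; exact: measurable_funX.
have mg2 : measurable_fun setT (fun x => (g x ^+ 2)%:E).
  by apply/measurable_EFinP; exact: measurable_funX.
apply: (@le_lt_trans _ _ (\int[mu]_x (2%:E * ((f x ^+ 2)%:E + (g x ^+ 2)%:E)))%E).
  apply: ge0_le_integral => //.
  - by move=> x _; rewrite lee_fin sqr_ge0.
  - by apply/measurable_EFinP; exact: measurable_funX.
  - by apply: emeasurable_funM => //; exact: emeasurable_funD.
  - move=> x _; rewrite -EFinD -EFinM lee_fin/= -subr_ge0.
    by rewrite (_ : _ - _ = (f x - g x) ^+ 2) ?sqr_ge0//; ring.
rewrite ge0_integralZl//; last 2 first.
- exact: emeasurable_funD.
- by move=> x _; rewrite adde_ge0// lee_fin sqr_ge0.
rewrite ge0_integralD//; try by move=> x _; rewrite lee_fin sqr_ge0.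
by rewrite lte_mul_pinfty ?lee_fin// lte_add_pinfty.
Qed.

Lemma sqintN f : sqint f -> sqint (\- f).
Proof.
move=> sf; apply: (sqint_le _ sf) => [|x]; last by rewrite normrN.
by case: sf => mf _; exact: measurable_funN.
Qed.

Lemma sqintB f g : sqint f -> sqint g -> sqint (f \- g).
Proof. by move=> sf sg; apply: (sqintD sf); exact: sqintN. Qed.

Lemma sqintZ (g f : X -> R) (c : R) : measurable_fun setT g ->
  (forall x, `|g x| <= c) -> sqint f -> sqint (fun x => g x * f x).
Proof.
move=> mg gc [mf foo].
have mf2 : measurable_fun setT (fun x => (f x ^+ 2)%:E).
  by apply/measurable_EFinP; exact: measurable_funX.
split; first exact: measurable_funM.
apply: (@le_lt_trans _ _ (\int[mu]_x ((c ^+ 2)%:E * (f x ^+ 2)%:E))%E).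
  apply: ge0_le_integral => //.
  - by move=> x _; rewrite lee_fin sqr_ge0.
  - by apply/measurable_EFinP; apply: measurable_funX; exact: measurable_funM.
  - exact: emeasurable_funM.
  - move=> x _; rewrite -EFinM lee_fin exprMn ler_wpM2r ?sqr_ge0//.
    by rewrite -(real_normK (num_real (g x))) ler_pXn2r ?nnegrE// (le_trans _ (gc x)).
rewrite ge0_integralZl//; last 2 first.
- by move=> x _; rewrite lee_fin sqr_ge0.
- by rewrite lee_fin sqr_ge0.
by rewrite lte_mul_pinfty ?lee_fin ?sqr_ge0.
Qed.

Lemma measurable_integrable (f : X -> R) :
  mu.-integrable setT (fun x => (f x)%:E) -> measurable_fun setT f.
Proof. by move=> /measurable_int/measurable_EFinP. Qed.

Lemma sqint_ae_eq0 f : sqint f -> \int[mu]_x (f x * f x) = 0 -> \forall x \ae mu, f x = 0.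
Proof.
move=> sf; have := sqintM_integrable sf sf => iff f0; case: sf => mf _.
have /(iffLR (ae_eq_integral_abs mu measurableT _)) :
    (\int[mu]_x `| (f x * f x)%:E |)%E = 0%E.
  under eq_integral do rewrite gee0_abs ?lee_fin -?expr2 ?sqr_ge0//.
  apply: (etrans (esym (fineK (integrable_fin_num measurableT iff)))).
  exact: (congr1 EFin f0).
move=> /(_ (measurable_int _ iff)); apply: filterS => x /(_ I) [/eqP].
by rewrite mulf_eq0 orbb => /eqP.
Qed.

Section transfer.
Variables (psi : X -> X) (p k : X -> R).
Hypothesis mpsi : measurable_fun setT psi.
Hypothesis mp : measurable_fun setT p.
Hypothesis mk : measurable_fun setT k.
Hypothesis p0 : forall x, 0 <= p x.
Hypothesis k0 : forall x, 0 <= k x.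
Hypothesis pk : forall g : X -> R, measurable_fun setT g -> (forall x, 0 <= g x) ->
  (\int[mu]_x (g (psi x) * p x)%:E = \int[mu]_x (g x * k x)%:E)%E.

(** Multiplication by p and k preserves positive and negative parts, as p and k
    are nonnegative. *)
Lemma transfer_signed (f : X -> R) : measurable_fun setT f ->
  mu.-integrable setT (fun x => (f x * k x)%:E) ->
  mu.-integrable setT (fun x => (f (psi x) * p x)%:E) /\
  \int[mu]_x (f (psi x) * p x) = \int[mu]_x (f x * k x).
Proof.
move=> mf /integrableP[_ fkoo]; split.
  apply/integrableP; split.
    apply/measurable_EFinP; apply: measurable_funM => //.
    exact: measurableT_comp.
  have := pk (measurableT_comp (@normr_measurable R setT) mf) (fun x => normr_ge0 (f x)).
  rewrite (eq_integral (fun x => `|(f (psi x) * p x)%:E|%E)); last first.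
    by move=> x _; rewrite /= normrM (ger0_norm (p0 x)).
  move=> ->; rewrite (eq_integral (fun x => `|(f x * k x)%:E|%E))//.
  by move=> x _; rewrite /= normrM (ger0_norm (k0 x)).
have part (q : X -> R) (ps : X -> X) : (forall x, 0 <= q x) ->
   (\int[mu]_x ((f (ps x) * q x)%:E) =
    \int[mu]_x (Num.max (f (ps x)) 0 * q x)%:E -
    \int[mu]_x (Num.max (- f (ps x)) 0 * q x)%:E)%E.
  move=> q0; rewrite integralE; congr (_ - _)%E; apply: eq_integral => x _.
    by rewrite funeposE -EFin_max maxr_pMl// mul0r.
  by rewrite funenegE -EFinN -EFin_max maxr_pMl// mul0r mulNr.
rewrite /Rintegral (part p psi)// (part k id)//; congr (fine (_ - _)%E).
  apply: (pk (g := fun x => Num.max (f x) 0)).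
    by apply: measurable_maxr.
  by move=> x; rewrite le_max lexx orbT.
apply: (pk (g := fun x => Num.max (- f x) 0)).
  by apply: measurable_maxr => //; exact: measurable_funN.
by move=> x; rewrite le_max lexx orbT.
Qed.

End transfer.

End real_L2.

(** * The Hilbert space of square integrable complex functions *)

Section complex_L2.
Context d (X : measurableType d) (R : realType).
Variable mu : {measure set X -> \bar R}.
Local Open Scope quotient_scope.

Local Notation Re := complex.Re.
Local Notation Im := complex.Im.

Lemma sqr_normcE (z : R[i]) : normc z ^+ 2 = Re z ^+ 2 + Im z ^+ 2.
Proof. by case: z => a b /=; rewrite sqr_sqrtr// addr_ge0// sqr_ge0. Qed.

Lemma measurable_L2 (F : L2 mu) : measurable_fun setT F.
Proof. exact: measurable_funPT. Qed.

Lemma L2_lty (F : L2 mu) : (\int[mu]_x ((normc (F x) ^+ 2)%:E) < +oo)%E.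
Proof. by have /asboolP := valP F. Qed.

Lemma sqint_Re (F : L2 mu) : sqint mu (fun x => Re (F x)).
Proof.
have /measurable_fun_complexP[mr mi] := measurable_L2 F.
split => //; apply: le_lt_trans (L2_lty F); apply: ge0_le_integral => //.
- by move=> x _; rewrite lee_fin sqr_ge0.
- by apply/measurable_EFinP; exact: measurable_funX.
- by apply/measurable_EFinP; apply: measurable_sqr_normc; exact: measurable_L2.
- by move=> x _; rewrite lee_fin sqr_normcE lerDl sqr_ge0.
Qed.

Lemma sqint_Im (F : L2 mu) : sqint mu (fun x => Im (F x)).
Proof.
have /measurable_fun_complexP[mr mi] := measurable_L2 F.
split => //; apply: le_lt_trans (L2_lty F); apply: ge0_le_integral => //.
- by move=> x _; rewrite lee_fin sqr_ge0.
- by apply/measurable_EFinP; exact: measurable_funX.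
- by apply/measurable_EFinP; apply: measurable_sqr_normc; exact: measurable_L2.
- by move=> x _; rewrite lee_fin sqr_normcE lerDr sqr_ge0.
Qed.

(** The chosen representative of the class of f agrees with f only almost
    everywhere, so properties of f are transported along this equality. *)
Lemma L2_mk (f : X -> R[i]) : sqint mu (fun x => Re (f x)) ->
  sqint mu (fun x => Im (f x)) -> exists F : L2 mu, \forall x \ae mu, F x = f x.
Proof.
move=> [mr roo] [mi ioo].
have mf : measurable_fun setT f by exact/measurable_fun_complexP.
pose f' : {mfun X >-> R[i]} := HB.pack f (isMeasurableFun.Build _ _ _ _ f mf).
pose F : {mfun_ mu, X >-> R[i]} := \pi f'.
have Ff : \forall x \ae mu, F x = f x.
  have /eqmodP/asboolP : repr F = f' %[mod {mfun_ mu, X >-> R[i]}] by rewrite reprK.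
  by apply: filterS => x; apply.
have Foo : `[< (\int[mu]_x ((normc (F x) ^+ 2)%:E) < +oo)%E >].
  apply/asboolP.
  rewrite (_ : (\int[mu]_x _)%E =
    (\int[mu]_x ((Re (f x) ^+ 2)%:E + (Im (f x) ^+ 2)%:E))%E).
    rewrite ge0_integralD//.
    - by rewrite lte_add_pinfty.
    - by move=> x _; rewrite lee_fin sqr_ge0.
    - by apply/measurable_EFinP; exact: measurable_funX.
    - by move=> x _; rewrite lee_fin sqr_ge0.
    - by apply/measurable_EFinP; exact: measurable_funX.
  apply: ge0_ae_eq_integral => //.
  - by apply/measurable_EFinP; apply: measurable_sqr_normc; exact: measurable_funPT.
  - by apply: emeasurable_funD; apply/measurable_EFinP; exact: measurable_funX.
  - by move=> x _; rewrite lee_fin sqr_ge0.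
  - by move=> x _; rewrite adde_ge0// lee_fin sqr_ge0.
  - by move: Ff; apply: filterS => x -> _; rewrite -EFinD sqr_normcE.
by exists (exist _ F Foo).
Qed.

Lemma L2_ext (F G : L2 mu) : (\forall x \ae mu, F x = G x) -> F = G.
Proof.
move=> FG; apply: val_inj.
rewrite -[LHS]reprK -[RHS]reprK; apply/eqmodP/asboolP.
by apply: filterS FG => x Fx _.
Qed.

Definition rdot (f g : X -> R) := \int[mu]_x (f x * g x).

Lemma rdotBr f g h : sqint mu f -> sqint mu g -> sqint mu h ->
  rdot f (fun x => g x - h x) = rdot f g - rdot f h.
Proof.
move=> sf sg sh; rewrite -RintegralB//; try exact: sqintM_integrable.
by apply: eq_Rintegral => x _; rewrite mulrBr.
Qed.

Lemma L2dotE (F G : L2 mu) : L2dot mu F G =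
  Complex (rdot (fun x => Re (F x)) (fun x => Re (G x)) +
           rdot (fun x => Im (F x)) (fun x => Im (G x)))
          (rdot (fun x => Im (F x)) (fun x => Re (G x)) -
           rdot (fun x => Re (F x)) (fun x => Im (G x))).
Proof.
have := sqint_Re F; have := sqint_Im F; have := sqint_Re G; have := sqint_Im G.
move=> ? ? ? ?.
rewrite /L2dot; congr Complex.
  rewrite -RintegralD//; try exact: sqintM_integrable.
  apply: eq_Rintegral => x _; case: (F x) (G x) => [a b] [a' b'] /=; ring.
rewrite -RintegralB//; try exact: sqintM_integrable.
apply: eq_Rintegral => x _; case: (F x) (G x) => [a b] [a' b'] /=; ring.
Qed.

Lemma ae_eq_Rintegral (f g : X -> R) : measurable_fun setT f -> measurable_fun setT g ->
  (\forall x \ae mu, f x = g x) -> \int[mu]_x f x = \int[mu]_x g x.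
Proof.
move=> mf mg fg; congr fine; apply: ae_eq_integral => //; try exact/measurable_EFinP.
by move: fg; apply: filterS => x ->.
Qed.

Lemma integrable_dotRe (F G : L2 mu) :
  mu.-integrable setT (fun x => (Re (F x * conjc (G x)))%:E).
Proof.
have := sqint_Re F; have := sqint_Im F; have := sqint_Re G; have := sqint_Im G.
move=> ? ? ? ?; rewrite (_ : (fun x => _) =
    (fun x => (Re (F x) * Re (G x))%:E + (Im (F x) * Im (G x))%:E)%E).
  by apply: integrableD => //; exact: sqintM_integrable.
apply/funext => x; rewrite -EFinD; congr EFin.
by case: (F x) (G x) => [a b] [a' b'] /=; ring.
Qed.

Lemma integrable_dotIm (F G : L2 mu) :
  mu.-integrable setT (fun x => (Im (F x * conjc (G x)))%:E).
Proof.
have := sqint_Re F; have := sqint_Im F; have := sqint_Re G; have := sqint_Im G.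
move=> ? ? ? ?; rewrite (_ : (fun x => _) =
    (fun x => (Im (F x) * Re (G x))%:E - (Re (F x) * Im (G x))%:E)%E).
  by apply: integrableB => //; exact: sqintM_integrable.
apply/funext => x; rewrite -EFinB; congr EFin.
by case: (F x) (G x) => [a b] [a' b'] /=; ring.
Qed.

Lemma ae_eq_integrable (f g : X -> R) : measurable_fun setT f ->
  mu.-integrable setT (EFin \o g) -> (\forall x \ae mu, g x = f x) ->
  mu.-integrable setT (EFin \o f).
Proof.
move=> mf /integrableP[mg goo] gf.
have mEf : measurable_fun setT (EFin \o f) by exact/measurable_EFinP.
apply/integrableP; split => //.
rewrite -(ge0_ae_eq_integral (f := fun x => `|(EFin \o g) x|%E))//.
- exact: measurableT_comp.
- exact: measurableT_comp.
- by apply: filterS gf => x /= -> _.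
Qed.

(** The test vector is U - V, whose inner product with itself is 0. *)
Lemma L2dot_inj (U V : L2 mu) : (forall G, L2dot mu G U = L2dot mu G V) -> U = V.
Proof.
move=> H.
have sUr := sqint_Re U; have sUi := sqint_Im U.
have sVr := sqint_Re V; have sVi := sqint_Im V.
have sr := sqintB sUr sVr; have si := sqintB sUi sVi.
have [D DE] := @L2_mk (fun x => Complex (Re (U x) - Re (V x)) (Im (U x) - Im (V x))) sr si.
have sDr := sqint_Re D; have sDi := sqint_Im D.
have DrE : rdot (fun x => Re (D x)) (fun x => Re (D x)) =
    rdot (fun x => Re (D x)) (fun x => Re (U x)) -
    rdot (fun x => Re (D x)) (fun x => Re (V x)).
  rewrite -rdotBr//; apply: ae_eq_Rintegral.
  - by apply: measurable_funM; case: sDr.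
  - by apply: measurable_funM; [case: sDr|case: sr].
  - by apply: filterS DE => x ->.
have DiE : rdot (fun x => Im (D x)) (fun x => Im (D x)) =
    rdot (fun x => Im (D x)) (fun x => Im (U x)) -
    rdot (fun x => Im (D x)) (fun x => Im (V x)).
  rewrite -rdotBr//; apply: ae_eq_Rintegral.
  - by apply: measurable_funM; case: sDi.
  - by apply: measurable_funM; [case: sDi|case: si].
  - by apply: filterS DE => x ->.
have rge0 f : 0 <= rdot f f by apply: Rintegral_ge0 => x _; rewrite -expr2 sqr_ge0.
have := H D; rewrite !L2dotE => -[/eqP + _]; rewrite -subr_eq0 opprD addrACA -DrE -DiE.
rewrite paddr_eq0// => /andP[/eqP /(sqint_ae_eq0 sDr) Dr0 /eqP /(sqint_ae_eq0 sDi) Di0].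
apply: L2_ext; apply: filterS3 DE Dr0 Di0 => x -> /= /eqP + /eqP.
by rewrite !subr_eq0; case: (U x) (V x) => [a b] [a' b'] /= /eqP -> /eqP ->.
Qed.

Section dot_transfer.
Variables (psi : X -> X) (u : X -> R[i]) (k : X -> R).
Hypothesis mpsi : measurable_fun setT psi.
Hypothesis mu_ : measurable_fun setT u.
Hypothesis mk : measurable_fun setT k.
Hypothesis k0 : forall x, 0 <= k x.
Hypothesis pk : forall g : X -> R, measurable_fun setT g -> (forall x, 0 <= g x) ->
  (\int[mu]_x (g (psi x) * normc (u x) ^+ 2)%:E = \int[mu]_x (g x * k x)%:E)%E.

(** Pointwise, U conj(V) is |u|^2 times the function (F conj(G)) o psi, and the
    integrals of such products transfer to X through k. For psi = phi^n and
    u = w_n this computes S^n T^n without any formula for S. *)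
Lemma L2dot_transfer (F G U V W : L2 mu) :
  (\forall x \ae mu, U x = u x * F (psi x)) ->
  (\forall x \ae mu, V x = u x * G (psi x)) ->
  (\forall x \ae mu, W x = (k x)%:C%C * G x) ->
  L2dot mu U V = L2dot mu F W.
Proof.
move=> UE VE WE.
have mp : measurable_fun setT (fun x => normc (u x) ^+ 2) by exact: measurable_sqr_normc.
have p0 x : 0 <= normc (u x) ^+ 2 by rewrite sqr_ge0.
have mprod (f g : X -> R) : measurable_fun setT f -> measurable_fun setT g ->
  measurable_fun setT (fun x => f x * g x) by exact: measurable_funM.
have step (f g g' : X -> R) : measurable_fun setT f ->
    mu.-integrable setT (fun x => (g' x)%:E) -> mu.-integrable setT (fun x => (g x)%:E) ->
    (\forall x \ae mu, g' x = normc (u x) ^+ 2 * f (psi x)) ->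
    (\forall x \ae mu, g x = f x * k x) ->
    \int[mu]_x g' x = \int[mu]_x g x.
  move=> mf ig' ig g'E gE.
  have mfk : measurable_fun setT (fun x => f x * k x) by exact: mprod.
  have ifk := ae_eq_integrable mfk ig gE.
  have [_ E] := transfer_signed mpsi mp p0 k0 pk mf ifk.
  rewrite (ae_eq_Rintegral (measurable_integrable ig) mfk gE) -E; apply: ae_eq_Rintegral.
  - exact: (measurable_integrable ig').
  - by apply: mprod => //; exact: measurableT_comp.
  - by apply: filterS g'E => x ->; rewrite mulrC.
rewrite /L2dot; congr Complex.
  apply: (step (fun x => Re (F x * conjc (G x)))).
  - exact/measurable_integrable/integrable_dotRe.
  - exact: integrable_dotRe.
  - exact: integrable_dotRe.
  - apply: filterS2 UE VE => x -> ->; rewrite sqr_normcE.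
    by case: (u x) (F (psi x)) (G (psi x)) => [a b] [a' b'] [a'' b''] /=; ring.
  - apply: filterS WE => x ->.
    by case: (F x) (G x) => [a b] [a' b'] /=; ring.
apply: (step (fun x => Im (F x * conjc (G x)))).
- exact/measurable_integrable/integrable_dotIm.
- exact: integrable_dotIm.
- exact: integrable_dotIm.
- apply: filterS2 UE VE => x -> ->; rewrite sqr_normcE.
  by case: (u x) (F (psi x)) (G (psi x)) => [a b] [a' b'] [a'' b''] /=; ring.
- apply: filterS WE => x ->.
  by case: (F x) (G x) => [a b] [a' b'] /=; ring.
Qed.

End dot_transfer.

(** The multiplication by a real function is self-adjoint. *)
Lemma L2dot_mulr (g : X -> R) (F G gF gG : L2 mu) :
  (\forall x \ae mu, gF x = (g x)%:C%C * F x) ->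
  (\forall x \ae mu, gG x = (g x)%:C%C * G x) ->
  L2dot mu gF G = L2dot mu F gG.
Proof.
move=> FE GE.
rewrite /L2dot; congr Complex; apply: ae_eq_Rintegral.
- exact/measurable_integrable/integrable_dotRe.
- exact/measurable_integrable/integrable_dotRe.
- apply: filterS2 FE GE => x -> ->.
  by case: (F x) (G x) => [a b] [a' b'] /=; ring.
- exact/measurable_integrable/integrable_dotIm.
- exact/measurable_integrable/integrable_dotIm.
- apply: filterS2 FE GE => x -> ->.
  by case: (F x) (G x) => [a b] [a' b'] /=; ring.
Qed.

Lemma L2_mulr (g : X -> R) (c : R) (F : L2 mu) : measurable_fun setT g ->
  (forall x, `|g x| <= c) -> exists G : L2 mu, \forall x \ae mu, G x = (g x)%:C%C * F x.
Proof.
move=> mg gc.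
have sr := sqintZ mg gc (sqint_Re F); have si := sqintZ mg gc (sqint_Im F).
have [G GE] := @L2_mk (fun x => Complex (g x * Re (F x)) (g x * Im (F x))) sr si.
exists G; apply: filterS GE => x ->.
by apply/eqP; rewrite eq_complex; case: (F x) => a b /=; apply/andP; split; apply/eqP; ring.
Qed.

End complex_L2.

(** * Pushing a weight forward *)

Section adjoint.
Context d (X : measurableType d) (R : realType).
Variables (mu : {sigma_finite_measure set X -> \bar R}) (phi : {mfun X >-> X})
  (w : {mfun X >-> R[i]}) (K : R).
Hypothesis K0 : 0 < K.
Hypothesis HK : forall A, measurable A -> (wmeas mu w (phi @^-1` A) <= K%:E * mu A)%E.
Local Notation Re := complex.Re.
Local Notation Im := complex.Im.

Let mphi : measurable_fun setT phi. Proof. exact: measurable_funPT. Qed.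

Let mw2 : measurable_fun setT (fun x => normc (w x) ^+ 2).
Proof. exact: measurable_sqr_normc. Qed.

Let mpreK A : measurable A -> measurable (phi @^-1` A).
Proof. exact: measurable_preimageT. Qed.

Lemma integral_comp_le (g : X -> \bar R) A : measurable_fun setT g ->
  (forall x, 0 <= g x)%E -> measurable A ->
  (\int[mu]_(x in phi @^-1` A) (g (phi x) * (normc (w x) ^+ 2)%:E) <=
   K%:E * \int[mu]_(x in A) g x)%E.
Proof.
move=> mg g0 mA.
have [hP hK] := wderiv_bounded mphi (ltW K0) HK.
have [h0 mh _] := hP.
have hfin := ae_fin_num h0 hK.
rewrite -(wmeas_integral mu w (f := g \o phi) (measurableT_comp mg mphi))//; last 2 first.
- by move=> x; exact: g0.
- exact: mpreK.
have := wderiv_change mphi hP hfin mg g0 mA => ->.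
rewrite -ge0_integralZl//; last 2 first.
- exact: measurable_funTS.
- by rewrite lee_fin ltW.
apply: ae_ge0_le_integral => //.
- by move=> x _; rewrite mule_ge0.
- by apply: measurable_funTS; exact: emeasurable_funM.
- by move=> x _; rewrite mule_ge0// lee_fin ltW.
- by apply: measurable_funTS; exact: emeasurable_funM.
- by apply: filterS hK => x hx _; rewrite muleC; exact: lee_wpmul2r.
Qed.

Section positive.
Variables (p v : X -> R).
Hypothesis mp : measurable_fun setT p.
Hypothesis p0 : forall x, 0 <= p x.
Hypothesis sv : sqint mu v.
Hypothesis pv : forall x, p x <= normc (w x) * `|v x|.

Let mv2 : measurable_fun setT (fun x => (v x ^+ 2)%:E).
Proof. by case: sv => mv _; apply/measurable_EFinP; exact: measurable_funX. Qed.

Let mEp : measurable_fun setT (fun x => (p x)%:E).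
Proof. exact/measurable_EFinP. Qed.

(** The density of the image of p mu under phi. Taking sqrt p as a weight turns
    p mu into a measure of the form [wmeas], to which the change of variables
    applies. The bound on p makes the image absolutely continuous, through
    |w|^2 mu, and finite on sets of finite measure. *)
Lemma pushed_weight : exists k : X -> R, [/\ measurable_fun setT k,
  forall x, 0 <= k x &
  forall (g : X -> R) A, measurable_fun setT g -> (forall x, 0 <= g x) -> measurable A ->
    (\int[mu]_(x in phi @^-1` A) (g (phi x) * p x)%:E =
     \int[mu]_(x in A) (g x * k x)%:E)%E].
Proof.
pose s x := (Num.sqrt (p x))%:C%C.
have ms : measurable_fun setT s.
  apply/measurable_fun_complexP; split; last exact: measurable_cst.
  rewrite (_ : (fun x => _) = (fun x => p x `^ 2^-1)).
    exact: (measurableT_comp (measurable_powR 2^-1) mp).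
  by apply/funext => x; rewrite powR12_sqrt.
pose S : {mfun X >-> R[i]} := HB.pack s (isMeasurableFun.Build _ _ _ _ s ms).
have sp x : normc (S x) ^+ 2 = p x.
  by rewrite sqr_normcE /= expr0n addr0 sqr_sqrtr.
have SE A : wmeas mu S A = (\int[mu]_(x in A) (p x)%:E)%E.
  by apply: eq_integral => x _; rewrite sp.
have [F [mF tF UF Foo]] := sigma_finite_trivIset mu.
have Smu A : measurable A -> mu A = 0%E -> wmeas mu S (phi @^-1` A) = 0%E.
  move=> mA A0; rewrite SE.
  have : wmeas mu w (phi @^-1` A) = 0%E.
    by apply/eqP; rewrite -measure_le0; apply: (le_trans (HK mA)); rewrite A0 mule0.
  have mEw : measurable_fun setT (fun x => (normc (w x) ^+ 2)%:E) by exact/measurable_EFinP.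
  rewrite /wmeas => w0.
  have /(ae_eq_integral_abs mu (mpreK mA)) : \forall x \ae mu, (phi @^-1` A) x -> (p x)%:E = 0%E.
    have : \forall x \ae mu, (phi @^-1` A) x -> (normc (w x) ^+ 2)%:E = 0%E.
      apply: (iffLR (ae_eq_integral_abs mu (mpreK mA) (measurable_funTS mEw))).
      by under eq_integral do rewrite gee0_abs ?lee_fin ?sqr_ge0//.
    apply: filterS => x /[apply] -[/eqP]; rewrite sqrf_eq0 => /eqP wx.
    by congr EFin; apply/eqP; rewrite eq_le p0 andbT (le_trans (pv x))// wx mul0r.
  under eq_integral do rewrite gee0_abs ?lee_fin//.
  by apply; exact: measurable_funTS.
have Soo i : (wmeas mu S (phi @^-1` F i) < +oo)%E.
  rewrite SE; apply: (@le_lt_trans _ _ (\int[mu]_(x in phi @^-1` F i)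
      ((normc (w x) ^+ 2)%:E + (v x ^+ 2)%:E))%E).
    apply: ge0_le_integral => //.
    - exact: mpreK.
    - by move=> x _; rewrite lee_fin.
    - exact: measurable_funTS.
    - by apply: measurable_funTS; apply: emeasurable_funD => //; exact/measurable_EFinP.
    - move=> x _; rewrite -EFinD lee_fin (le_trans (pv x))//.
      rewrite -(real_normK (num_real (v x))).
      have n0 : 0 <= normc (w x) by case: (w x) => a b /=; rewrite sqrtr_ge0.
      move: (normc (w x)) `|v x| n0 (normr_ge0 (v x)) => a b a0 b0.
      rewrite -subr_ge0; have := sqr_ge0 (a - b); have := mulr_ge0 a0 b0.
      by rewrite sqrrB; lra.
  rewrite ge0_integralD//.
  - apply: lte_add_pinfty.
      apply: (le_lt_trans (HK (mF i))); rewrite lte_mul_pinfty ?lee_fin ?ltW//.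
    case: sv => _; apply: le_lt_trans; apply: ge0_subset_integral => //.
      exact: mpreK.
    by move=> x _; rewrite lee_fin sqr_ge0.
  - exact: mpreK.
  - by move=> x _; rewrite lee_fin sqr_ge0.
  - by apply: measurable_funTS; exact/measurable_EFinP.
  - by move=> x _; rewrite lee_fin sqr_ge0.
  - exact: measurable_funTS.
pose la := pushforward_measure (wmeas mu S) mphi.
have [h [h0 mh hE]] := @density_exists _ _ _ mu la F Smu mF tF UF Soo.
have hP : is_wderiv mu phi S h by split => // A mA; exact: (hE _ mA).
have hfin : \forall x \ae mu, h x \is a fin_num.
  have H i : \forall x \ae mu, F i x -> h x \is a fin_num.
    apply: (@integrable_ae _ _ _ mu (F i)) => //.
    apply/integrableP; split; first exact: measurable_funTS.
    by under eq_integral do rewrite gee0_abs//; rewrite -hE//; exact: Soo.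
  have := @ae_foralln _ _ _ mu _ H; apply: filterS => x Hx.
  have : (\bigcup_i F i) x by rewrite UF.
  by move=> [i _ /Hx].
have mfh : measurable_fun setT (fine \o h) by exact: measurableT_comp.
exists (fine \o h); split => //.
  by move=> x; exact: fine_ge0.
move=> g A mg g0 mA.
have mEg : measurable_fun setT (EFin \o g) by exact/measurable_EFinP.
have Eg0 x : (0 <= (EFin \o g) x)%E by rewrite lee_fin.
have := wderiv_change mphi hP hfin mEg Eg0 mA.
rewrite (wmeas_integral mu S (f := fun x => (g (phi x))%:E)); last 3 first.
- exact: (measurableT_comp mEg mphi).
- by move=> x; rewrite lee_fin.
- exact: mpreK.
under eq_integral do rewrite sp -EFinM.
move=> ->; apply: ge0_ae_eq_integral => //.
- by apply: measurable_funTS; exact: emeasurable_funM.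
- by apply: measurable_funTS; apply/measurable_EFinP; exact: measurable_funM.
- by move=> x _; rewrite mule_ge0.
- by move=> x _; rewrite lee_fin mulr_ge0// fine_ge0.
- by apply: filterS hfin => x hx _; rewrite /= EFinM fineK.
Qed.

(** On a set A where k is bounded, test k against itself: by the inequality of
    arithmetic and geometric means, 2 k(phi) p <= |w|^2 k(phi)^2 / K + K v^2, and
    the first term integrates to at most the integral of k^2 over A. Hence
    2 I <= I + K |v|^2 with I finite. The constant K in the inequality is
    the one that makes I reappear with coefficient 1. *)
Lemma pushed_weight_sqint (k : X -> R) : measurable_fun setT k -> (forall x, 0 <= k x) ->
  (forall (g : X -> R) A, measurable_fun setT g -> (forall x, 0 <= g x) -> measurable A ->
    (\int[mu]_(x in phi @^-1` A) (g (phi x) * p x)%:E =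
     \int[mu]_(x in A) (g x * k x)%:E)%E) -> sqint mu k.
Proof.
move=> mk k0 H; split => //.
have [F [mF tF UF Foo]] := sigma_finite_trivIset mu.
(* an increasing exhaustion by sets of finite measure on which k is bounded *)
pose G m := [set x | k x <= m%:R] `&` \big[setU/set0]_(i < m) F i.
have mU m : measurable (\big[setU/set0]_(i < m) F i) by exact: bigsetU_measurable.
have mG m : measurable (G m).
  apply: measurableI => //.
  have := mk measurableT `]-oo, m%:R]%classic (measurable_itv _).
  by rewrite setTI set_itvE.
have Uoo m : (mu (\big[setU/set0]_(i < m) F i) < +oo)%E.
  elim: m => [|m ih]; first by rewrite big_ord0 measure0.
  rewrite big_ord_recr/=; apply: le_lt_trans (measureU2 _ (mU m) (mF m)) _.
  by apply: lte_add_pinfty => //; exact: Foo.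
have Goo m : (mu (G m) < +oo)%E.
  by apply: le_lt_trans (Uoo m); apply: le_measure; rewrite ?inE//; exact: subIsetr.
have mk2 : measurable_fun setT (fun x => (k x ^+ 2)%:E).
  by apply/measurable_EFinP; exact: measurable_funX.
have mkp : measurable_fun setT (fun x => k (phi x)) by exact: (measurableT_comp mk mphi).
pose V := (\int[mu]_x (v x ^+ 2)%:E)%E.
have bound m : (\int[mu]_(x in G m) (k x ^+ 2)%:E <= K%:E * V)%E.
  set I := (\int[mu]_(x in G m) _)%E.
  have Ifin : I \is a fin_num.
    rewrite ge0_fin_numE; last by apply: integral_ge0 => x _; rewrite lee_fin sqr_ge0.
    apply: (@le_lt_trans _ _ (\int[mu]_(x in G m) cst (m%:R ^+ 2)%:E x)%E).
      apply: ge0_le_integral => //.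
      - by move=> x _; rewrite lee_fin sqr_ge0.
      - exact: measurable_funTS.
      - by move=> x [kx _]; rewrite lee_fin ler_pXn2r ?nnegrE.
    rewrite integral_cst//; apply: lte_mul_pinfty => //; last exact: Goo.
  have : (2%:E * I <= I + K%:E * V)%E.
    have -> : (2%:E * I = \int[mu]_(x in phi @^-1` G m) (2%:E * (k (phi x) * p x)%:E))%E.
      rewrite ge0_integralZl//.
      - by rewrite H.
      - exact: mpreK.
      - by apply: measurable_funTS; apply/measurable_EFinP; exact: measurable_funM.
      - by move=> x _; rewrite lee_fin mulr_ge0.
    apply: (@le_trans _ _ (\int[mu]_(x in phi @^-1` G m)
        (K^-1%:E * ((k (phi x) ^+ 2)%:E * (normc (w x) ^+ 2)%:E) + K%:E * (v x ^+ 2)%:E))%E).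
      apply: ge0_le_integral => //.
      - exact: mpreK.
      - by move=> x _; rewrite mule_ge0// lee_fin mulr_ge0.
      - apply: measurable_funTS; apply: emeasurable_funM => //.
        by apply/measurable_EFinP; exact: measurable_funM.
      - apply: measurable_funTS; apply: emeasurable_funD; apply: emeasurable_funM => //.
        apply: emeasurable_funM; last exact/measurable_EFinP.
        by apply/measurable_EFinP; exact: measurable_funX.
      - move=> x _; rewrite -!EFinM -EFinD lee_fin.
        have n0 : 0 <= normc (w x) by case: (w x) => a b /=; rewrite sqrtr_ge0.
        apply: (@le_trans _ _ (2 * (k (phi x) * (normc (w x) * `|v x|)))).
          by rewrite ler_wpM2l// ler_wpM2l.
        rewrite -(real_normK (num_real (v x))).
        move: (normc (w x)) `|v x| (k (phi x)) => a b c.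
        rewrite -subr_ge0 (_ : _ - _ = K^-1 * (c * a - K * b) ^+ 2).
          by rewrite mulr_ge0 ?sqr_ge0// invr_ge0 ltW.
        by field; rewrite gt_eqF.
    rewrite ge0_integralD//; last 5 first.
    - exact: mpreK.
    - move=> x _; rewrite -!EFinM lee_fin mulr_ge0 ?invr_ge0 ?(ltW K0)//.
      by rewrite mulr_ge0 ?sqr_ge0.
    - apply: measurable_funTS; apply: emeasurable_funM => //.
      apply: emeasurable_funM; last exact/measurable_EFinP.
      by apply/measurable_EFinP; exact: measurable_funX.
    - by move=> x _; rewrite -EFinM lee_fin mulr_ge0 ?sqr_ge0// ltW.
    - by apply: measurable_funTS; exact: emeasurable_funM.
    apply: leeD.
      rewrite ge0_integralZl//; last 4 first.
      - exact: mpreK.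
      - apply: measurable_funTS; apply: emeasurable_funM; last exact/measurable_EFinP.
        by apply/measurable_EFinP; exact: measurable_funX.
      - by move=> x _; rewrite -EFinM lee_fin mulr_ge0 ?sqr_ge0.
      - by rewrite lee_fin invr_ge0 ltW.
      rewrite -[leRHS]mul1e -(@mulVf _ K) ?gt_eqF// EFinM -muleA.
      apply: lee_wpmul2l; first by rewrite lee_fin invr_ge0 ltW.
      apply: (integral_comp_le (g := fun x => (k x ^+ 2)%:E)) => //.
      by move=> x; rewrite lee_fin sqr_ge0.
    rewrite ge0_integralZl//; last 4 first.
    - exact: mpreK.
    - exact: measurable_funTS.
    - by move=> x _; rewrite lee_fin sqr_ge0.
    - by rewrite lee_fin ltW.
    apply: lee_wpmul2l; first by rewrite lee_fin ltW.
    apply: ge0_subset_integral => //; first exact: mpreK.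
    by move=> x _; rewrite lee_fin sqr_ge0.
  rewrite -(fineK Ifin) -EFinM mulr_natl mulr2n EFinD.
  by rewrite leeD2lE.
have GT : \bigcup_m G m = setT.
  apply/seteqP; split => // x _.
  have [i _ Fx] : (\bigcup_i F i) x by rewrite UF.
  pose m := maxn i.+1 (Num.truncn (k x)).+1.
  exists m => //; split => /=.
    apply: ltW; apply: lt_le_trans (truncnS_gt _) _.
    by rewrite ler_nat leq_maxr.
  by rewrite -bigcup_mkord; exists i => //=; rewrite leq_maxl.
have Gnd : nondecreasing_seq G.
  move=> a b ab; apply/subsetPset => x [/= kx Ux]; split => /=.
    by rewrite (le_trans kx)// ler_nat.
  move: Ux; rewrite -!bigcup_mkord => -[i /= ia Fx]; exists i => //=.
  exact: leq_trans ia ab.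
have kG : (\int[mu]_(x in G m) (k x ^+ 2)%:E @[m --> \oo] -->
    \int[mu]_(x in \bigcup_m G m) (k x ^+ 2)%:E)%E.
  apply: ge0_nondecreasing_set_cvg_integral => //.
  - by move=> m; exact: measurable_funTS.
  - by move=> m x _; rewrite lee_fin sqr_ge0.
rewrite GT in kG.
apply: (@le_lt_trans _ _ (K%:E * V)%E); last first.
  by case: sv => _ Voo; rewrite lte_mul_pinfty// lee_fin ltW.
rewrite -(cvg_lim _ kG)//; apply: lime_le; first by apply/cvg_ex; eexists; exact: kG.
by apply: nearW.
Qed.

End positive.
End adjoint.

(** * The adjoint of a weighted composition operator *)

Section adjoint2.
Context d (X : measurableType d) (R : realType).
Variables (mu : {sigma_finite_measure set X -> \bar R}) (phi : {mfun X >-> X})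
  (w : {mfun X >-> R[i]}) (K : R).
Hypothesis K0 : 0 < K.
Hypothesis HK : forall A, measurable A -> (wmeas mu w (phi @^-1` A) <= K%:E * mu A)%E.
Local Notation Re := complex.Re.
Local Notation Im := complex.Im.

Let mphi : measurable_fun setT phi. Proof. exact: measurable_funPT. Qed.

Lemma normc_ge0 (z : R[i]) : 0 <= normc z.
Proof. by case: z => a b; exact: sqrtr_ge0. Qed.

Lemma norm_Re_le (z : R[i]) : `|Re z| <= normc z.
Proof.
rewrite -(@ler_pXn2r _ 2) ?nnegrE ?normc_ge0// sqr_normcE real_normK ?num_real//.
by rewrite lerDl sqr_ge0.
Qed.

Lemma norm_Im_le (z : R[i]) : `|Im z| <= normc z.
Proof.
rewrite -(@ler_pXn2r _ 2) ?nnegrE ?normc_ge0// sqr_normcE real_normK ?num_real//.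
by rewrite lerDr sqr_ge0.
Qed.

Lemma pushed_weight_pos (p v : X -> R) : measurable_fun setT p -> (forall x, 0 <= p x) ->
  sqint mu v -> (forall x, p x <= normc (w x) * `|v x|) ->
  exists2 k : X -> R, sqint mu k & forall f : X -> R, sqint mu f ->
    mu.-integrable setT (fun x => (f (phi x) * p x)%:E) /\
    \int[mu]_x (f (phi x) * p x) = \int[mu]_x (f x * k x).
Proof.
move=> mp p0 sv pv.
have [k [mk k0 kE]] := pushed_weight K0 HK mp p0 sv pv.
have sk := pushed_weight_sqint K0 HK mp p0 sv pv mk k0 kE.
exists k => // f sf; apply: (transfer_signed mphi mp p0 k0) => //.
- by move=> g mg g0; have := kE g setT mg g0 measurableT; rewrite preimage_setT.
- by case: sf.
- exact: sqintM_integrable.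
Qed.

Lemma pushed_weight_real (p v : X -> R) : measurable_fun setT p ->
  sqint mu v -> (forall x, `|p x| <= normc (w x) * `|v x|) ->
  exists2 k : X -> R, sqint mu k & forall f : X -> R, sqint mu f ->
    mu.-integrable setT (fun x => (f (phi x) * p x)%:E) /\
    \int[mu]_x (f (phi x) * p x) = \int[mu]_x (f x * k x).
Proof.
move=> mp sv pv.
pose q x := Num.max (p x) 0; pose r x := Num.max (- p x) 0.
have [||||k1 s1 H1] := @pushed_weight_pos q v => //.
- exact: measurable_maxr.
- by move=> x; rewrite le_max lexx orbT.
- move=> x; rewrite /q ge_max mulr_ge0 ?normc_ge0// andbT.
  by apply: le_trans (pv x); exact: ler_norm.
have [||||k2 s2 H2] := @pushed_weight_pos r v => //.
- by apply: measurable_maxr => //; exact: measurable_funN.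
- by move=> x; rewrite le_max lexx orbT.
- move=> x; rewrite /r ge_max mulr_ge0 ?normc_ge0// andbT.
  by apply: le_trans (pv x); rewrite -normrN; exact: ler_norm.
exists (k1 \- k2); first exact: sqintB.
move=> f sf; have [i1 E1] := H1 f sf; have [i2 E2] := H2 f sf.
have pqr x : f (phi x) * p x = f (phi x) * q x - f (phi x) * r x.
  rewrite -mulrBr; congr (_ * _); rewrite /q /r; have [px|px] := leP 0 (p x).
    by rewrite max_r ?subr0// oppr_le0.
  by rewrite max_l ?oppr_ge0 1?ltW// sub0r opprK.
split.
  rewrite (_ : (fun x => _) = (fun x => (f (phi x) * q x)%:E - (f (phi x) * r x)%:E)%E).
    exact: integrableB.
  by apply/funext => x; rewrite pqr.
transitivity (\int[mu]_x (f (phi x) * q x - f (phi x) * r x)).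
  by apply: eq_Rintegral => x _.
rewrite RintegralB// E1 E2 -RintegralB//; try exact: sqintM_integrable.
by apply: eq_Rintegral => x _; rewrite mulrBr.
Qed.

(** The adjoint maps G to the conjugate of the density of the image of the
    complex measure (w conj(G)) mu, obtained from the positive and negative
    parts of its real and imaginary parts. *)
Lemma adjoint_exists (T : L2 mu -> L2 mu) :
  (forall F, \forall x \ae mu, T F x = w x * F (phi x)) ->
  exists S, is_adjoint (L2dot mu) T S.
Proof.
move=> TE.
suff H G : exists V, forall F, L2dot mu (T F) G = L2dot mu F V.
  by have [S SE] := choice H; exists S => F G.
pose p x := w x * conjc (G x); pose v x := normc (G x).
have /measurable_fun_complexP[mGr mGi] := measurable_L2 G.
have mG' : measurable_fun setT (fun x => conjc (G x)).
  apply/measurable_fun_complexP; split.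
    by rewrite (_ : (fun x => _) = (fun x => Re (G x)))//; apply/funext => x; case: (G x).
  rewrite (_ : (fun x => _) = (fun x => - Im (G x))); first exact: measurable_funN.
  by apply/funext => x; case: (G x).
have mp : measurable_fun setT p by exact: measurable_mulC.
have /measurable_fun_complexP[mpr mpi] := mp.
have mv : measurable_fun setT v.
  rewrite (_ : v = fun x => (normc (G x) ^+ 2) `^ 2^-1).
    apply: (measurableT_comp (measurable_powR 2^-1)).
    exact: measurable_sqr_normc (measurable_L2 G).
  by apply/funext => x; rewrite powR12_sqrt ?sqr_ge0// sqrtr_sqr ger0_norm// normc_ge0.
have sv : sqint mu v by split => //; exact: L2_lty.
have pv x : normc (p x) = normc (w x) * `|v x|.
  rewrite normcM ger0_norm ?normc_ge0//; congr (_ * _).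
  by rewrite /v; case: (G x) => a b /=; rewrite sqrrN.
have [|k1 s1 H1] := @pushed_weight_real (fun x => Re (p x)) v mpr sv.
  by move=> x; rewrite -pv norm_Re_le.
have [|k2 s2 H2] := @pushed_weight_real (fun x => Im (p x)) v mpi sv.
  by move=> x; rewrite -pv norm_Im_le.
have [V VE] := @L2_mk _ _ _ mu (fun x => Complex (k1 x) (- k2 x)) s1 (sqintN s2).
exists V => F; have sr := sqint_Re F; have si := sqint_Im F.
have [ir1 Er1] := H1 _ sr; have [ii1 Ei1] := H1 _ si.
have [ir2 Er2] := H2 _ sr; have [ii2 Ei2] := H2 _ si.
have jr1 := sqintM_integrable sr s1; have ji1 := sqintM_integrable si s1.
have jr2 := sqintM_integrable sr s2; have ji2 := sqintM_integrable si s2.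
rewrite /L2dot; congr Complex.
- transitivity (\int[mu]_x (Re (F (phi x)) * Re (p x) - Im (F (phi x)) * Im (p x))).
    apply: ae_eq_Rintegral.
    + exact/measurable_integrable/integrable_dotRe.
    + by apply: measurable_funB; exact: (measurable_integrable (mu := mu)).
    + apply: filterS (TE F) => x ->; rewrite /p.
      by case: (w x) (F (phi x)) (G x) => [a b] [a' b'] [a'' b''] /=; ring.
  rewrite RintegralB// Er1 Ei2 -RintegralB//; apply: ae_eq_Rintegral.
  + by apply: measurable_funB; exact: (measurable_integrable (mu := mu)).
  + exact/measurable_integrable/integrable_dotRe.
  + by apply: filterS VE => x ->; case: (F x) => a b /=; ring.
- transitivity (\int[mu]_x (Re (F (phi x)) * Im (p x) + Im (F (phi x)) * Re (p x))).
    apply: ae_eq_Rintegral.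
    + exact/measurable_integrable/integrable_dotIm.
    + by apply: measurable_funD; exact: (measurable_integrable (mu := mu)).
    + apply: filterS (TE F) => x ->; rewrite /p.
      by case: (w x) (F (phi x)) (G x) => [a b] [a' b'] [a'' b''] /=; ring.
  rewrite RintegralD// Er2 Ei1 -RintegralD//; apply: ae_eq_Rintegral.
  + by apply: measurable_funD; exact: (measurable_integrable (mu := mu)).
  + exact/measurable_integrable/integrable_dotIm.
  + by apply: filterS VE => x ->; case: (F x) => a b /=; ring.
Qed.

End adjoint2.

(** * Centered operators and the factorisation of the derivatives *)

Section operators.
Context d (X : measurableType d) (R : realType).
Variables (mu : {sigma_finite_measure set X -> \bar R}) (phi : {mfun X >-> X})
  (w : {mfun X >-> R[i]}) (K : R).
Hypothesis K0 : 0 < K.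
Hypothesis HK : forall A, measurable A -> (wmeas mu w (phi @^-1` A) <= K%:E * mu A)%E.
Local Notation Re := complex.Re.
Local Notation Im := complex.Im.
Local Notation nu := (nu_iter mu phi w).
Local Notation h := (h_iter mu phi w).
Local Notation fact := (factorises mu phi w).
Local Notation wn := (wprod phi w).

Let K0' : 0 <= K := ltW K0.
Let hP n : is_wderiv mu (iter n phi) (wn n) (h n).
Proof. by have [] := h_iterP K0' HK n. Qed.

(** A version of h_n that is real valued and bounded at every point, so that the
    multiplication by it is defined on all of L2. *)
Definition h_real n x := Num.min (fine (h n x)) (K ^+ n).

Lemma measurable_h_real n : measurable_fun setT (h_real n).
Proof.
apply: measurable_minr => //.
by apply: measurableT_comp => //; exact: measurable_h_iter K0' HK n.
Qed.

Lemma h_real_ge0 n x : 0 <= h_real n x.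
Proof. by rewrite le_min exprn_ge0// andbT fine_ge0// (h_iter_ge0 K0' HK). Qed.

Lemma h_real_le n x : `|h_real n x| <= K ^+ n.
Proof. by rewrite ger0_norm ?h_real_ge0// ge_min lexx orbT. Qed.

Lemma h_realE n : \forall x \ae mu, h n x = (h_real n x)%:E.
Proof.
have [_ hK _] := h_iterP K0' HK n; have hf := h_iter_fin K0' HK n.
apply: filterS2 hK hf => x hK hf.
by rewrite /h_real min_l ?fineK// -lee_fin fineK.
Qed.

Lemma h_real_transfer n (g : X -> R) : measurable_fun setT g -> (forall x, 0 <= g x) ->
  (\int[mu]_x (g (iter n phi x) * normc (wn n x) ^+ 2)%:E =
   \int[mu]_x (g x * h_real n x)%:E)%E.
Proof.
move=> mg g0.
have mEg : measurable_fun setT (EFin \o g) by exact/measurable_EFinP.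
have Eg0 x : (0 <= (EFin \o g) x)%E by rewrite lee_fin.
have := wderiv_change (measurable_iter phi n) (hP n) (h_iter_fin K0' HK n) mEg Eg0 measurableT.
rewrite preimage_setT (wmeas_integral mu (wn n) (f := fun x => (g (iter n phi x))%:E))//;
  last 2 first.
- exact: (measurableT_comp mEg (measurable_iter phi n)).
- by move=> x; rewrite lee_fin.
under eq_integral do rewrite -EFinM.
move=> ->; apply: ge0_ae_eq_integral => //.
- by apply: emeasurable_funM => //; exact: measurable_h_iter K0' HK n.
- by apply/measurable_EFinP; apply: measurable_funM => //; exact: measurable_h_real.
- by move=> x _; rewrite mule_ge0// (h_iter_ge0 K0' HK).
- by move=> x _; rewrite lee_fin mulr_ge0// h_real_ge0.
- by have := h_realE n; apply: filterS => x -> _.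
Qed.

Lemma ae_comp_weight n (P : X -> Prop) : (\forall x \ae mu, P x) ->
  \forall x \ae mu, wn n x != 0 -> P (iter n phi x).
Proof. by move=> /(ae_comp_iter_mu K0' HK n) /ae_wmeasP. Qed.

Variable T : L2 mu -> L2 mu.
Hypothesis TE : forall F, \forall x \ae mu, T F x = w x * F (phi x).

Lemma iter_wcompE n F : \forall x \ae mu, iter n T F x = wn n x * F (iter n phi x).
Proof.
elim: n => [|n ih]; first by apply: aeW => x; rewrite wprod0 mul1r.
apply: filterS2 (ae_comp_weight 1 ih) (TE (iter n T F)) => x; rewrite wprod1 => E.
rewrite iterS => ->; rewrite -add1n wprodD wprod1 iterD /= -mulrA.
have [->|/E/= ->//] := eqVneq (w x) 0; first by rewrite !mul0r.
by rewrite -iterS iterSr.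
Qed.

Section with_adjoint.
Variable S : L2 mu -> L2 mu.
Hypothesis TS : is_adjoint (L2dot mu) T S.

Lemma iter_adjoint n : is_adjoint (L2dot mu) (iter n T) (iter n S).
Proof. by elim: n => // n ih F G; rewrite iterS TS ih -iterSr. Qed.

Lemma iter_adjoint_iterE n F : \forall x \ae mu, iter n S (iter n T F) x = (h_real n x)%:C%C * F x.
Proof.
have [W WE] := L2_mulr F (measurable_h_real n) (h_real_le n).
suff -> : iter n S (iter n T F) = W by [].
apply: L2dot_inj => G; rewrite -iter_adjoint.
exact: (L2dot_transfer (measurable_iter phi n) (measurable_wprod phi w n)
  (measurable_h_real n) (h_real_ge0 n) (h_real_transfer n)
  (iter_wcompE n G) (iter_wcompE n F) WE).
Qed.

Lemma indicator_L2 (A : set X) : measurable A -> (mu A < +oo)%E ->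
  exists J : L2 mu, \forall x \ae mu, J x = (\1_A x : R)%:C%C.
Proof.
move=> mA Aoo.
apply: (@L2_mk _ _ _ mu (fun x => (\1_A x : R)%:C%C)).
  split => /=; first exact: measurable_indic.
  rewrite (eq_integral (fun x => (\1_A x)%:E)); first by rewrite integral_indic// setIT.
  by move=> x _; rewrite indicE; case: (x \in A); rewrite ?expr1n ?expr0n.
split => /=; first exact: measurable_cst.
by rewrite integral0_eq// => x _; rewrite expr0n.
Qed.

(** Both products are applied to T J, where J is the indicator of a set of finite
    measure. As S S^n T^n T = S^(n+1) T^(n+1) is the multiplication by h_(n+1),
    the two results are h_n w . (h_1 J) o phi and w . (h_(n+1) J) o phi. *)
Lemma commute_factorises n :
  (iter n S \o iter n T) \o (iter 1 T \o iter 1 S) =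
  (iter 1 T \o iter 1 S) \o (iter n S \o iter n T) -> fact n 1.
Proof.
move=> C; have [F [mF tF UF Foo]] := sigma_finite_trivIset mu.
suff H i : \forall x \ae nu 1, F i (iter 1 phi x) ->
    h_real (n + 1) (iter 1 phi x) = h_real n x * h_real 1 (iter 1 phi x).
  have H1 := @ae_foralln _ _ _ (nu 1) _ H.
  have H2 := ae_comp_iter_mu K0' HK 1 (h_realE (n + 1)).
  have H3 := ae_comp_iter_mu K0' HK 1 (h_realE 1).
  have H4 := ae_nu_iter phi w 1 (h_realE n).
  rewrite /factorises; near=> x.
  have -> : h (n + 1) (iter 1 phi x) = (h_real (n + 1) (iter 1 phi x))%:E by near: x.
  have -> : h 1 (iter 1 phi x) = (h_real 1 (iter 1 phi x))%:E by near: x.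
  have -> : h n x = (h_real n x)%:E by near: x.
  rewrite -EFinM; congr EFin.
  have [i _ Fx] : (\bigcup_i F i) (iter 1 phi x) by rewrite UF.
  have /(_ i Fx) : forall i, F i (iter 1 phi x) ->
    h_real (n + 1) (iter 1 phi x) = h_real n x * h_real 1 (iter 1 phi x) by near: x.
  by [].
have [J JE] := indicator_L2 (mF i) (Foo i).
apply/ae_wmeasP.
have E : iter n S (iter n T (T (S (T J)))) = T (iter n.+1 S (iter n.+1 T J)).
  by have := congr1 (fun f => f (T J)) C; rewrite /= -(iterSr n T J).
have H1 := TE (S (T J)); have H2 := ae_comp_weight 1 (iter_adjoint_iterE 1 J).
have H3 := iter_adjoint_iterE n (T (S (T J))).
have H4 := TE (iter n.+1 S (iter n.+1 T J)).
have H5 := ae_comp_weight 1 (iter_adjoint_iterE n.+1 J).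
have H6 := ae_comp_weight 1 JE.
near=> x.
have E1 : T (S (T J)) x = w x * S (T J) (phi x) by near: x.
have E2 : wn 1 x != 0 -> S (T J) (iter 1 phi x) = (h_real 1 (iter 1 phi x))%:C%C * J (iter 1 phi x).
  by near: x.
have E3 : iter n S (iter n T (T (S (T J)))) x = (h_real n x)%:C%C * T (S (T J)) x by near: x.
have E4 : T (iter n.+1 S (iter n.+1 T J)) x = w x * iter n.+1 S (iter n.+1 T J) (phi x) by near: x.
have E5 : wn 1 x != 0 -> iter n.+1 S (iter n.+1 T J) (iter 1 phi x) =
    (h_real n.+1 (iter 1 phi x))%:C%C * J (iter 1 phi x).
  by near: x.
have E6 : wn 1 x != 0 -> J (iter 1 phi x) = (\1_(F i) (iter 1 phi x) : R)%:C%C by near: x.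
move=> wx Fx.
have := E3; rewrite E E4 E1 (E2 wx) (E5 wx) (E6 wx) indicE mem_set// !mulr1.
have wx0 : w x != 0 by move: wx; rewrite /= wprod1.
rewrite mulrCA => /(mulfI wx0); rewrite -rmorphM => /(congr1 (@complex.Re R)) /=.
by rewrite addn1.
Unshelve. all: by end_near. Qed.


(** The relation makes h_k equal to g o phi^n for nu_n with g bounded, so that
    h_k . T^n F = T^n (g F); passing to adjoints, S^n (h_k f) = g . S^n f. *)
Lemma factorises_commute n k : fact k n -> forall f,
  iter k S (iter k T (iter n T (iter n S f))) =
  iter n T (iter n S (iter k S (iter k T f))).
Proof.
move=> H.
have [_ _ Hc] := h_iterP K0' HK n.
have [r [r0 mr _ _ rE]] := condexp_factor (measurable_iter phi n) (hP n) (h_iter_fin K0' HK n)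
   Hc (measurable_h_iter K0' HK k) (measurable_h_iter K0' HK (k + n))
   (h_iter_ge0 K0' HK (k + n)) (integral_h_iter1 K0' HK k n).
have /(condexp_h_iter_fixP K0' HK) hE := H.
pose g x := Num.min (fine (r x)) (K ^+ k).
have g0 x : 0 <= g x by rewrite le_min exprn_ge0// andbT fine_ge0.
have gK x : `|g x| <= K ^+ k by rewrite ger0_norm// ge_min lexx orbT.
have mg : measurable_fun setT g.
  by apply: measurable_minr => //; exact: measurableT_comp.
have gE : \forall x \ae mu, wn n x != 0 -> h_real k x = g (iter n phi x).
  by apply/ae_wmeasP; apply: filterS2 hE rE => x; rewrite /g /h_real => -> ->.
have TM (F U : L2 mu) : (\forall x \ae mu, U x = (g x)%:C%C * F x) ->
    iter n T U = iter k S (iter k T (iter n T F)).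
  move=> UE; apply: L2_ext.
  have H1 := iter_wcompE n U; have H2 := ae_comp_weight n UE.
  have H3 := iter_adjoint_iterE k (iter n T F); have H4 := iter_wcompE n F.
  near=> x.
  have -> : iter n T U x = wn n x * U (iter n phi x) by near: x.
  have -> : iter k S (iter k T (iter n T F)) x = (h_real k x)%:C%C * iter n T F x by near: x.
  have -> : iter n T F x = wn n x * F (iter n phi x) by near: x.
  have [->|wx] := eqVneq (wn n x) 0; first by rewrite !mul0r mulr0.
  have -> : h_real k x = g (iter n phi x).
    by move: wx; near: x.
  have -> : U (iter n phi x) = (g (iter n phi x))%:C%C * F (iter n phi x).
    by move: wx; near: x.
  by rewrite mulrCA.
move=> f; have [U UE] := L2_mulr (iter n S f) mg gK.
suff -> : iter n S (iter k S (iter k T f)) = U by rewrite (TM _ _ UE).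
apply: L2dot_inj => F; have [V VE] := L2_mulr F mg gK.
rewrite -iter_adjoint -(L2dot_mulr (iter_adjoint_iterE k (iter n T F)) (iter_adjoint_iterE k f)).
by rewrite -(TM _ _ VE) iter_adjoint (L2dot_mulr VE UE).
Unshelve. all: by end_near. Qed.

Lemma factorises_centered : (forall n k, (0 < n)%N -> (0 < k)%N -> fact n k) ->
  centered (L2dot mu) T.
Proof.
move=> H; exists S => //.
pose P n := iter n T \o iter n S; pose Q n := iter n S \o iter n T.
have PQ n k : P n \o Q k = Q k \o P n.
  case: n => [|n]; first by [].
  case: k => [|k]; first by [].
  by apply/funext => f; exact: (esym (factorises_commute (H k.+1 n.+1 isT isT) f)).
have QQ n k : Q n \o Q k = Q k \o Q n.
  apply/funext => f; apply: L2_ext.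
  apply: filterS2 (filterI (iter_adjoint_iterE n (Q k f)) (iter_adjoint_iterE k f))
    (filterI (iter_adjoint_iterE k (Q n f)) (iter_adjoint_iterE n f)) => x [E1 E2] [E3 E4].
  by rewrite /= [LHS]E1 E2 [RHS]E3 E4 mulrCA.
(* T^n (S^n T^n) (T^j S^j) S^n : exchange the two middle factors *)
have PPD n j : P n \o P (n + j) = P (n + j) \o P n.
  apply/funext => f.
  have eT y : iter (n + j) T y = iter n T (iter j T y) by rewrite iterD.
  have eS y : iter (n + j) S y = iter j S (iter n S y) by rewrite addnC iterD.
  rewrite /P /= !eT !eS; congr (iter n T _).
  exact: (congr1 (fun F => F (iter n S f)) (esym (PQ j n))).
have PP n k : P n \o P k = P k \o P n.
  by case: (leqP n k) => [|/ltnW] nk; rewrite -(subnKC nk) PPD.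
move=> family A B [n _ AE] [k _ BE].
by case: AE => ->; case: BE => ->; [exact: PP|exact: PQ|exact: esym (PQ _ _)|exact: QQ].
Qed.

End with_adjoint.
End operators.

(** * The two normalised weights *)

Section weights.
Context d (X : measurableType d) (R : realType).
Variables (mu : {sigma_finite_measure set X -> \bar R}) (phi : {mfun X >-> X})
  (w : {mfun X >-> R[i]}) (K : R).
Hypothesis K0 : 0 < K.
Hypothesis HK : forall A, measurable A -> (wmeas mu w (phi @^-1` A) <= K%:E * mu A)%E.
Local Notation nu := (nu_iter mu phi w).
Local Notation h := (h_iter mu phi w).
Local Notation wn := (wprod phi w).
Let K0' : 0 <= K := ltW K0.

Lemma sqrt_prod n (F : 'I_n -> R) : (forall j, 0 <= F j) ->
  Num.sqrt (\prod_(j < n) F j) = \prod_(j < n) Num.sqrt (F j).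
Proof.
move=> F0; apply: (proj2 (A := 0 <= \prod_(j < n) F j)).
elim/big_ind2 : _ => [|x1 x2 y1 y2 [x10 <-] [y10 <-]|j _]; rewrite ?sqrtr1//.
by split; [exact: mulr_ge0|rewrite sqrtrM].
Qed.

Definition derivs_real n x : R := \prod_(j < n) fine (h 1 (iter j.+1 phi x)).

Lemma derivs_real_ge0 n x : 0 <= derivs_real n x.
Proof. by apply: prodr_ge0 => j _; rewrite fine_ge0// (h_iter_ge0 K0' HK). Qed.

Lemma derivs_realE n : \forall x \ae nu n,
  (\prod_(1 <= j < n.+1) h 1 (iter j phi x) = (derivs_real n x)%:E)%E.
Proof.
have H (j : nat) : \forall x \ae nu n, (j < n)%N -> h 1 (iter j.+1 phi x) \is a fin_num.
  have [jn|_] := ltnP j n; last by apply: aeW.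
  have := ae_comp_iter_mu K0' HK j.+1 (h_iter_fin K0' HK 1).
  move=> /(ae_nu_iterD (n - j.+1)%N); rewrite subnKC//.
  by apply: filterS => x + _.
have := @ae_foralln _ _ _ (nu n) _ H; apply: filterS => x Hx.
rewrite big_add1 big_mkord /derivs_real (big_morph EFin EFinM erefl).
by apply: eq_bigr => j _; rewrite fineK// Hx.
Qed.

Lemma wprod_normalE n x : wprod_normal mu phi w n x =
  if wn n x == 0 then 0 else wn n x / (Num.sqrt (derivs_real n x))%:C%C.
Proof.
rewrite /wprod_normal; case: ifP => // _.
rewrite prodf_div; congr (_ / _).
rewrite /derivs_real sqrt_prod; last first.
  by move=> j; rewrite fine_ge0// (h_iter_ge0 K0' HK).
rewrite rmorph_prod; apply: eq_bigr => j _.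
by rewrite h_iter_one.
Qed.

Lemma product_weights_eq n : derivative_product mu phi w n ->
  wcomp mu (iter n phi) (wprod_polar mu phi w n) =
  wcomp mu (iter n phi) (wprod_normal mu phi w n).
Proof.
move=> H.
have E : \forall x \ae mu, wprod_polar mu phi w n x = wprod_normal mu phi w n x.
  have /ae_wmeasP H1 := H; have /ae_wmeasP H2 := derivs_realE n.
  apply: filterS2 H1 H2 => x H1 H2; rewrite wprod_normalE /wprod_polar.
  have [//|wx] := eqVneq (wn n x) 0.
  by rewrite -/(h_iter mu phi w n _) -(H1 wx) (H2 wx).
apply/seteqP; split => -[F G] /=; apply: filterS2 E => x E /(_ I) /= <- _; by rewrite E.
Qed.

Variable T : L2 mu -> L2 mu.
Hypothesis TE : forall F, \forall x \ae mu, T F x = w x * F (phi x).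

(** The two weights are compared on the function sqrt(h_n) J, with J the
    indicator of a set of finite measure: the polar weight maps it to T^n J, so
    that its image is known to be square integrable. *)
Lemma weights_eq_product n :
  wcomp mu (iter n phi) (wprod_polar mu phi w n) =
  wcomp mu (iter n phi) (wprod_normal mu phi w n) -> derivative_product mu phi w n.
Proof.
move=> E.
have [F [mF tF UF Foo]] := sigma_finite_trivIset mu.
suff H i : \forall x \ae nu n, F i (iter n phi x) ->
    derivs_real n x = h_real mu phi w K n (iter n phi x).
  have H1 := @ae_foralln _ _ _ (nu n) _ H.
  have H2 := ae_comp_iter_mu K0' HK n (h_realE K0 HK n).
  apply: filterS3 H1 H2 (derivs_realE n) => x H1 -> ->.
  have [i _ Fx] : (\bigcup_i F i) (iter n phi x) by rewrite UF.
  by rewrite (H1 i Fx).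
have [J JE] := indicator_L2 (mF i) (Foo i).
pose s x := Num.sqrt (h_real mu phi w K n x).
have ms : measurable_fun setT s.
  rewrite (_ : s = fun x => h_real mu phi w K n x `^ 2^-1).
    exact: (measurableT_comp (measurable_powR 2^-1) (measurable_h_real K0 HK n)).
  by apply/funext => x; rewrite powR12_sqrt ?(h_real_ge0 K0 HK).
have sK x : `|s x| <= Num.sqrt (K ^+ n).
  rewrite ger0_norm ?sqrtr_ge0// ler_wsqrtr//.
  by apply: le_trans (h_real_le K0 HK n x); exact: ler_norm.
have [G GE] := L2_mulr J ms sK.
have TJ := iter_wcompE K0 HK TE n J.
have GE' := ae_comp_weight K0 HK n GE; have JE' := ae_comp_weight K0 HK n JE.
have hE := ae_comp_weight K0 HK n (h_realE K0 HK n).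
have /ae_wmeasP hn0 := h_iter_neq0 K0' HK n.
have H1 : wcomp mu (iter n phi) (wprod_polar mu phi w n) (G, iter n T J).
  rewrite /wcomp /=; near=> x => _.
  have -> : iter n T J x = wn n x * J (iter n phi x) by near: x.
  rewrite /wprod_polar; have [->|wx] := eqVneq (wn n x) 0; first by rewrite !mul0r.
  have -> : G (iter n phi x) = (s (iter n phi x))%:C%C * J (iter n phi x).
    by move: wx; near: x.
  rewrite -/(h_iter mu phi w n _).
  have hx : h n (iter n phi x) = (h_real mu phi w K n (iter n phi x))%:E.
    by move: wx; near: x.
  have hx0 : h n (iter n phi x) != 0%E by move: wx; near: x.
  rewrite hx /= -/(s _) mulrA divfK//.
  rewrite (inj_eq (@complexI _)) sqrtr_eq0 -ltNge lt_neqAle (h_real_ge0 K0 HK) andbT eq_sym.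
  by move: hx0; rewrite hx eqe.
(* the only use of the equality of the two operators *)
have {}H1 : wcomp mu (iter n phi) (wprod_normal mu phi w n) (G, iter n T J).
  by rewrite -E.
apply/ae_wmeasP; move: H1; rewrite /wcomp /= => H1.
near=> x => wx Fx.
have JE1 : J (iter n phi x) = (\1_(F i) (iter n phi x) : R)%:C%C by move: wx; near: x.
have GE1 : G (iter n phi x) = (s (iter n phi x))%:C%C * J (iter n phi x).
  by move: wx; near: x.
have TJ1 : iter n T J x = wn n x * J (iter n phi x) by near: x.
have : wprod_normal mu phi w n x * G (iter n phi x) = iter n T J x.
  have : setT x by []. by near: x.
rewrite TJ1 GE1 JE1 indicE mem_set// !mulr1 wprod_normalE (negbTE wx).
set D := Num.sqrt (derivs_real n x).
have [->|D0 e] := eqVneq D 0; first by rewrite invr0 mulr0 mul0r => /esym/eqP; rewrite (negbTE wx).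
have DC0 : D%:C%C != 0 :> R[i] by rewrite (inj_eq (@complexI _)).
have : (s (iter n phi x))%:C%C = D%:C%C :> R[i].
  by apply: (mulfI (mulf_neq0 wx (invr_neq0 DC0))); rewrite e divfK.
move=> /(congr1 (@complex.Re R)) /= sD.
by rewrite -[LHS]sqr_sqrtr ?derivs_real_ge0// -/D -sD sqr_sqrtr// (h_real_ge0 K0 HK).
Unshelve. all: by end_near. Qed.

End weights.

Section bound.
Context d (X : measurableType d) (R : realType).
Variables (mu : {sigma_finite_measure set X -> \bar R}) (phi : {mfun X >-> X})
  (w : {mfun X >-> R[i]}).
Variable T : L2 mu -> L2 mu.
Hypothesis C_well_defined : wc_well_defined mu phi w.
Hypothesis C_bounded : bounded_op T.
Hypothesis TE : forall F, \forall x \ae mu, T F x = w x * F (phi x).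

(** For A of finite measure this is the norm inequality for the indicator of A.
    The added 1 makes K positive, so that the case of infinite measure is
    trivial. *)
Lemma wmeas_bound : exists2 K : R, 0 < K &
  forall A, measurable A -> (wmeas mu w (phi @^-1` A) <= K%:E * mu A)%E.
Proof.
have [M MT] := C_bounded; exists (M ^+ 2 + 1) => [|A mA].
  by rewrite ltr_wpDl// sqr_ge0.
have M0 : 0 < M ^+ 2 + 1 by rewrite ltr_wpDl// sqr_ge0.
have [->|Aoo] := eqVneq (mu A) +oo%E; first by rewrite gt0_muley ?lte_fin// leey.
rewrite -ltey in Aoo; have [J JE] := indicator_L2 mA Aoo.
have mphi : measurable_fun setT phi by exact: measurable_funPT.
have sqoo (F : L2 mu) : ((L2norm F ^+ 2)%:E = \int[mu]_x (normc (F x) ^+ 2)%:E)%E.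
  rewrite /L2norm sqr_sqrtr; last by apply: Rintegral_ge0 => x _; exact: sqr_ge0.
  rewrite fineK// ge0_fin_numE; first exact: L2_lty.
  by apply: integral_ge0 => x _; rewrite lee_fin sqr_ge0.
have msq (F : L2 mu) : measurable_fun setT (fun x => (normc (F x) ^+ 2)%:E).
  by apply/measurable_EFinP; apply: measurable_sqr_normc; exact: measurable_L2.
have JA : (\int[mu]_x (normc (J x) ^+ 2)%:E = mu A)%E.
  rewrite -(setIT A) -integral_indic//; apply: ge0_ae_eq_integral => //.
  - by apply/measurable_EFinP; exact: measurable_indic.
  - by move=> x _; rewrite lee_fin sqr_ge0.
  - apply: filterS JE => x -> _; rewrite sqr_normcE /= expr0n addr0 indicE.
    by case: (x \in A); rewrite ?expr1n ?expr0n.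
have TJA : (\int[mu]_x (normc (T J x) ^+ 2)%:E = wmeas mu w (phi @^-1` A))%E.
  rewrite /wmeas [RHS]integral_mkcond; apply: ge0_ae_eq_integral => //.
  - apply/(measurable_restrictT _ _).1.
      exact: measurable_preimageT.
    apply: measurable_funTS; apply/measurable_EFinP; exact: measurable_sqr_normc.
  - by move=> x _; rewrite lee_fin sqr_ge0.
  - by move=> x _; apply: erestrict_ge0 => y _; rewrite lee_fin sqr_ge0.
  - have JE' : \forall x \ae wmeas mu w, J (phi x) = (\1_A (phi x) : R)%:C%C.
      apply: (ae_comp mphi _ JE) => B mB B0.
      by have /null_content_dominatesP := C_well_defined; apply.
    have /ae_wmeasP {}JE' := JE'.
    apply: filterS2 (TE J) JE' => x -> H _; rewrite normcM exprMn patchE.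
    have [wx|/H ->] := eqVneq (w x) 0.
      by rewrite wx normc0 expr0n/= mul0r; case: ifP.
    have -> : (x \in phi @^-1` A) = (phi x \in A) by apply/idP/idP; rewrite !inE.
    rewrite sqr_normcE /= expr0n addr0 indicE.
    case: (phi x \in A); first by rewrite expr1n sqrtr1 expr1n mulr1.
    by rewrite expr0n sqrtr0 expr0n mulr0.
have := MT J; rewrite -TJA -JA -!sqoo => le.
rewrite -EFinM lee_fin mulrDl mul1r -exprMn.
apply: ler_wpDr; first exact: sqr_ge0.
rewrite ler_pXn2r ?nnegrE ?sqrtr_ge0//.
by apply: le_trans le; exact: sqrtr_ge0.
Qed.

End bound.

(** * The equivalence *)

Theorem theorem6 (d : measure_display) (X : measurableType d) (R : realType)
    (mu : {sigma_finite_measure set X -> \bar R})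
    (phi : {mfun X >-> X}) (w : {mfun X >-> R[i]})
    (T : L2 mu -> L2 mu)
    (C_well_defined : wc_well_defined mu phi w)
    (C_everywhere_defined : wcomp mu phi w = [set FG | FG.2 = T FG.1])
    (C_bounded : bounded_op T) :
  let w_ n := wprod phi w n in
  let mu_ n := wmeas mu (w_ n) in
  let h1 := wderiv mu phi w in
  let h n := wderiv mu (iter n phi) (w_ n) in
  let E1 f := wcondexp mu phi w f in
  let E n f := wcondexp mu (iter n phi) (w_ n) f in
  [<->
    (* A *) centered (L2dot mu) T;
    (* B *) forall n, (0 < n)%N ->
      wcomp mu (iter n phi) (wprod_polar mu phi w n) =
      wcomp mu (iter n phi) (wprod_normal mu phi w n);
    (* C *) forall n, (0 < n)%N -> \forall x \ae mu_ n,
      (\prod_(1 <= j < n.+1) h1 (iter j phi x))%E = h n (iter n phi x);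
    (* D *) forall n, (0 < n)%N -> \forall x \ae wmeas mu w,
      h n x = E1 (h n) x;
    (* E *) forall n, (0 < n)%N -> \forall x \ae wmeas mu w,
      h n.+1 (phi x) = (h n x * h1 (phi x))%E;
    (* F *) forall n, (0 < n)%N -> \forall x \ae mu_ n,
      h1 x = E n h1 x;
    (* G *) forall n, (0 < n)%N -> \forall x \ae mu_ n.+1,
      E n h1 (phi x) = E n.+1 (h1 \o phi) x;
    (* H *) forall n k, (0 < n)%N -> (0 < k)%N -> \forall x \ae mu_ k,
      h n x = E k (h n) x].
Proof.
move=> w_ mu_ h1 h E1 E.
have TE F : \forall x \ae mu, T F x = w x * F (phi x).
  have : wcomp mu phi w (F, T F) by rewrite C_everywhere_defined.
  by apply: filterS => x /(_ I) /= ->.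
have [K K0 HK] := wmeas_bound C_well_defined C_bounded TE.
have K0' := ltW K0.
pose fact := factorises mu phi w.
pose allfact := forall n k, (0 < n)%N -> (0 < k)%N -> fact n k.
have h1E : h1 = h_iter mu phi w 1 by rewrite /h1 h_iter_one.
have fact1_all : (forall n, (0 < n)%N -> fact n 1) -> allfact.
  exact: factorises_all K0' HK.
have prodP : (forall n, (0 < n)%N -> derivative_product mu phi w n) <-> allfact.
  split=> [/(product_factorises K0' HK)//|H].
  by apply: (factorises_product K0' HK) => n n0; exact: H.
have CE : (forall n, (0 < n)%N -> \forall x \ae mu_ n,
      (\prod_(1 <= j < n.+1) h1 (iter j phi x))%E = h n (iter n phi x)) <-> allfact.
  by rewrite -prodP h1E.
have fixP n k : fact n k <-> \forall x \ae mu_ k, h n x = E k (h n) x.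
  exact: condexp_h_iter_fixP K0' HK n k.
have DE n : (\forall x \ae wmeas mu w, h n x = E1 (h n) x) <-> fact n 1.
  by rewrite fixP /mu_ /E /w_ /E1 wprod1.
have EE n : (\forall x \ae wmeas mu w, h n.+1 (phi x) = (h n x * h1 (phi x))%E) <-> fact n 1.
  by rewrite /fact /factorises nu_iter_one -h1E addn1.
have FE n : (\forall x \ae mu_ n, h1 x = E n h1 x) <-> fact 1 n.
  by rewrite fixP h1E.
have GE n : (\forall x \ae mu_ n.+1, E n h1 (phi x) = E n.+1 (h1 \o phi) x) <-> fact 1 n.
  rewrite h1E; split; first exact: (condexp_shift_factorises K0' HK).
  exact: (factorises_condexp_shift K0' HK).
have BE n : wcomp mu (iter n phi) (wprod_polar mu phi w n) =
      wcomp mu (iter n phi) (wprod_normal mu phi w n) <-> derivative_product mu phi w n.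
  split; first exact: (weights_eq_product K0 HK TE).
  exact: (product_weights_eq K0 HK).
have F_all : (forall n, (0 < n)%N -> fact 1 n) -> allfact.
  by move=> /(factorises_product K0' HK) /prodP.
tfae.
- move=> [S TS comm] n n0; apply/BE; move: n n0; apply/prodP/fact1_all => n n0.
  apply: (commute_factorises K0 HK TE TS); apply: comm.
    by exists n => //; right.
  by exists 1 => //; left.
- by move=> H; apply/CE/prodP => n n0; apply/BE/H.
- by move=> /CE H n n0; apply/DE; exact: H.
- by move=> H n n0; apply/EE/DE/H.
- move=> H; have {}H : allfact by apply: fact1_all => n n0; apply/EE/H.
  by move=> n n0; apply/FE; exact: H.
- by move=> H n n0; apply/GE/FE/H.
- move=> H; have {}H : allfact by apply: F_all => n n0; apply: (iffLR (GE n)); exact: H.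
  by move=> n k n0 k0; apply: (iffLR (fixP n k)); exact: H.
- move=> H; have {}H : allfact by move=> n k n0 k0; apply: (iffRL (fixP n k)); exact: H.
  have [S TS] := adjoint_exists K0 HK TE.
  exact: (factorises_centered K0 HK TE TS H).
Qed.
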